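(* Fix $\theta\in(0,\tfrac23)$ and $\gamma\ge 0$. Consider the four drifting games V1, V2, V3, V4 with $N$ chips and $T$ rounds, where for V1 and V2 the parameter $\delta\in[0,1]$ is determined by $\gamma=\delta^2T/2$, and for V3 and V4 the parameter $R\ge 0$ is determined by $\gamma=R^2/(2T)$. Let $s_i$ denote the final position of chip $i$. In the following, $O(\cdot)$ is understood as $T\to\infty$ with $\gamma,\theta$ fixed, and the implied constants depend only on $\gamma$ and $\theta$ (not on $N$, $T$ or the opponent's strategy). (a) For V1 and for V3: there exists a potential-based player strategy such that, against every adversary strategy, $$\frac1N\sum_{i=1}^N L(s_i)\le \frac{1}{\sqrt\pi}\int_{\sqrt\gamma}^\infty e^{-x^2}\,dx+O(T^{-\theta/4}).$$ Moreover, when $N$ is sufficiently large, meaning $N\ge N_0(T)$ for a threshold $N_0(T)$ bounded by a polynomial in $T$, for every player strategy there exists an adversary strategy such that $$\frac1N\sum_{i=1}^N L(s_i)\ge \frac{1}{\sqrt\pi}\int_{\sqrt\gamma}^\infty e^{-x^2}\,dx-O(T^{-\theta/4}).$$ (b) For V2 and for V4: there exists a potential-based player strategy such that, against every adversary strategy, $$\frac1N\sum_{i=1}^N L(s_i)\le \frac{2}{\sqrt\pi}\int_{\sqrt\gamma}^\infty e^{-x^2}\,dx+O(T^{-\theta/2}).$$ Moreover, when $N$ is sufficiently large, meaning $N\ge N_0(T)$ for a threshold $N_0(T)$ bounded by a polynomial in $T$, for every player strategy there exists an adversary strategy such that $$\frac1N\sum_{i=1}^N L(s_i)\ge \frac{2}{\sqrt\pi}\int_{\sqrt\gamma}^\infty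 e^{-x^2}\,dx-O(T^{-\theta/4}).$$
   Context: Drifting game. Data: number of chips $N$, set of permitted moves $\mathcal Z\subset\mathbb R$, parameter $\delta\ge0$, number of rounds $T$, loss function $L:\mathbb R\to[0,\infty)$. All chips start at $0$. In each of the $T$ rounds, indexed by $t=-T,-T+1,\dots,-1$, the player announces a probability vector $p=(p_1,\dots,p_N)$ (nonnegative entries summing to $1$); then the adversary, knowing $p$, chooses $z=(z_1,\dots,z_N)$ with $z_i\in\mathcal Z$ for every $i$ and $\sum_{i=1}^N p_iz_i\ge\delta$, and chip $i$ is moved by $z_i$. After $T$ rounds, the final position $s_i$ is the sum of all moves of chip $i$, and the player's loss is $\frac1N\sum_{i=1}^N L(s_i)$. A player strategy is a rule choosing $p$ in each round from the history of play; an adversary strategy is a rule choosing an admissible $z$ in each round from the history of play and the current $p$. A player strategy is called potential-based if it is given by a potential, i.e. a function $\Lambda(\mathbf s,t)=\frac1N\sum_{i=1}^N f(s_i,t)$ of the chip positions $\mathbf s=(s_1,\dots,s_N)$ and of time, nonincreasing in each $s_i$, as follows: in round $t$, with chips at $\mathbf s$, the player takes $p$ proportional to $-\nabla\Lambda(\mathbf s,t+1)$, where $\nabla$ is the gradient in $\mathbf s$ (chips at which $f(\cdot,t+1)$ is not differentiable get weight $0$, and if all weights vanish any probability vector may be used). The four versions are: V1: $\mathcal Z=\{-1,1\}$, $\delta\ge0$, $L(s)=\mathbf 1_{\{s\le 0\}}$. V2: $\mathcal Z=[-1,1]$, $\delta\ge0$, $L(s)=\mathbf 1_{\{s\le 0\}}$.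 V3: $\mathcal Z=\{-1,1\}$, $\delta=0$, $L(s)=\mathbf 1_{\{s\le -R\}}$ with $R\ge0$. V4: $\mathcal Z=[-1,1]$, $\delta=0$, $L(s)=\mathbf 1_{\{s\le -R\}}$ with $R\ge0$. In V1 and V2 it is assumed that $\delta\le1$. *)

(* Defs.v *)
From HB Require Import structures.
From mathcomp Require Export all_boot all_order all_algebra.
From mathcomp Require Export all_classical all_reals all_analysis.
Set Implicit Arguments.
Unset Strict Implicit.
Unset Printing Implicit Defensive.
Import Order.TTheory GRing.Theory Num.Theory.
Import numFieldNormedType.Exports.
Local Open Scope classical_set_scope.
Local Open Scope ring_scope.

Record drifting_game (R : realType) := DriftingGame {
  moves : set R;
  drift : R;
  loss : R -> R
}.

Inductive version := V1 | V2 | V3 | V4.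

(* The real parameter [a] is delta for V1 and V2, and R for V3 and V4. *)
Definition game_of (R : realType) (v : version) (a : R) : drifting_game R :=
  match v with
  | V1 => DriftingGame [set -1; 1] a \1_[set s | s <= 0]
  | V2 => DriftingGame `[-1, 1] a \1_[set s | s <= 0]
  | V3 => DriftingGame [set -1; 1] 0 \1_[set s | s <= - a]
  | V4 => DriftingGame `[-1, 1] 0 \1_[set s | s <= - a]
  end.

Definition calibrated (R : realType) (v : version) (gamma : R) (T : nat)
    (a : R) : Prop :=
  match v with
  | V1 | V2 => 0 <= a <= 1 /\ gamma = a ^+ 2 * T%:R / 2
  | V3 | V4 => 0 <= a /\ gamma = a ^+ 2 / (2 * T%:R)
  end.

Section play.
Context {R : realType} {N : nat}.

(* Entry k of a history is the pair (p, z) of the k-th round played. *)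
Definition history := seq ('rV[R]_N * 'rV[R]_N).

Definition positions (h : history) : 'rV[R]_N := \sum_(r <- h) r.2.

Definition prob_vector (p : 'rV[R]_N) : Prop :=
  (forall i, 0 <= p 0 i) /\ \sum_(i < N) p 0 i = 1.

Definition admissible (G : drifting_game R) (p z : 'rV[R]_N) : Prop :=
  (forall i, moves G (z 0 i)) /\ drift G <= \sum_(i < N) p 0 i * z 0 i.

Definition player_strategy (sigma : history -> 'rV[R]_N) : Prop :=
  forall h, prob_vector (sigma h).

Definition adversary_strategy (G : drifting_game R)
    (tau : history -> 'rV[R]_N -> 'rV[R]_N) : Prop :=
  forall h p, prob_vector p -> admissible G p (tau h p).

Fixpoint play (sigma : history -> 'rV[R]_N)
    (tau : history -> 'rV[R]_N -> 'rV[R]_N) (k : nat) : history :=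
  if k is k'.+1 then
    let h := play sigma tau k' in rcons h (sigma h, tau h (sigma h))
  else [::].

Definition final_loss (G : drifting_game R) (T : nat) sigma tau : R :=
  N%:R^-1 * \sum_(i < N) loss G (positions (play sigma tau T) 0 i).

Definition Lambda (f : R -> int -> R) (s : 'rV[R]_N) (t : int) : R :=
  N%:R^-1 * \sum_(i < N) f (s 0 i) t.

Definition weights (f : R -> int -> R) (s : 'rV[R]_N) (t : int) : 'rV[R]_N :=
  \row_(i < N) if `[< derivable (fun x => f x t) (s 0 i) 1 >]
               then - 'D_(delta_mx 0 i) (fun u => Lambda f u t) s
               else 0.

(* After k rounds of a T-round game the current round is t = k - T, and the
   weights are taken at time t + 1. When they all vanish sigma is
   unconstrained. *)
Definition given_by_potential (T : nat) (f : R -> int -> R)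
    (sigma : history -> 'rV[R]_N) : Prop :=
  forall h : history, (size h < T)%N ->
    let w := weights f (positions h) ((size h)%:Z - T%:Z + 1) in
    w != 0 -> exists2 c : R, 0 < c & sigma h = c *: w.

End play.
Arguments history : clear implicits.

(* Monotonicity in each s_i of Lambda is monotonicity of f, as N > 0. *)
Definition potential (R : realType) (T : nat) (f : R -> int -> R) : Prop :=
  forall t : int, - T%:Z <= t <= 0 -> {homo (fun x => f x t) : x y /~ x <= y}.

Definition gauss_tail (R : realType) (gamma : R) : R :=
  \int[@lebesgue_measure R]_(x in `[Num.sqrt gamma, +oo[) expR (- x ^+ 2).

(* The guarantee holds for every strategy given by f, i.e. however the rounds
   in which all weights vanish are resolved: were those choices existential,
   a constant f would make every strategy potential-based. *)
Definition potential_upper_bound (R : realType) (v : version)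
    (gamma main rate : R) : Prop :=
  exists (C : R) (T0 : nat), forall (T N : nat) (a : R),
    (T0 <= T)%N -> (0 < N)%N -> calibrated v gamma T a ->
    exists f : R -> int -> R, [/\ potential T f,
      exists sigma : history R N -> 'rV[R]_N,
        player_strategy sigma /\ given_by_potential T f sigma &
      forall sigma : history R N -> 'rV[R]_N,
        player_strategy sigma -> given_by_potential T f sigma ->
      forall tau, adversary_strategy (game_of v a) tau ->
        final_loss (game_of v a) T sigma tau <= main + C * T%:R `^ (- rate)].

Definition adversary_lower_bound (R : realType) (v : version)
    (gamma main rate : R) : Prop :=
  exists (C : R) (T0 : nat) (N0 : nat -> nat) (P : {poly R}),
    (forall T, (N0 T)%:R <= P.[T%:R]) /\
    forall (T N : nat) (a : R),
      (T0 <= T)%N -> (0 < N)%N -> (N0 T <= N)%N -> calibrated v gamma T a ->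
      forall sigma : history R N -> 'rV[R]_N, player_strategy sigma ->
      exists2 tau, adversary_strategy (game_of v a) tau &
        main - C * T%:R `^ (- rate) <= final_loss (game_of v a) T sigma tau.

(* Main.v *)
Require Import Defs.
From mathcomp Require Import measurable_realfun zify ring lra.
Import Order.TTheory GRing.Theory Num.Theory.
Import numFieldNormedType.Exports.
Local Open Scope classical_set_scope.
Local Open Scope ring_scope.

(** Let [v(x, a)] be the probability that a normal variable of variance [a]
    exceeds [x]; it solves [v_a = v_xx / 2]. With [m] rounds left, a chip at [s]
    is given the coordinate [x = s + rho + d * m], in which it starts at
    [sqrt (2 gamma T)], loses if it ends at [x <= 0], and is held still by a move
    equal to the drift [d]. Take the clock [a = m + tau], where [tau >= 1] smooths
    the terminal condition. A round with move [z = 1] or [z = -1] changes [v] by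
    [- w (z - d)], where [w = - v_x], up to an error of order
    [a^(-3/2) + d^2 / a], whose sum over the rounds is [O(tau^(-1/2))]. The player
    weights the chips by [w], so the sum of these changes is nonpositive up to
    errors. The adversary starts from the fractional move [z = d] and rounds it:
    a linear program with two constraints (on [p] and on the potential) has a
    solution with one fractional chip, so each round loses at most [1 / N].
    With moves in [[-1, 1]] the potential is [min (1, 2 v)]: [2 v] is convex
    where it is below [1], so interior moves do not help the adversary there,
    and the adversary parks the chips that have come close to [x = 0].
    The bounds come from [tau = T^(1/3)] with the coordinate shifted by [tau], or,
    for the player's bound with moves in [[-1, 1]], [tau = T^(2/3)] without shift. *)

(** * The normal tail *)

Section gaussian.
Context {R : realType}.
Implicit Types x y : R.

Let mu := @lebesgue_measure R.

(* [Psi y] is the probability that a standard normal variable [U] exceeds [y],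
   written with [x = U / sqrt 2] to match [gauss_tail]. *)
Definition Psi y : R := 1 -
  (Num.sqrt pi)^-1 * \int[mu]_(x in `]-oo, y / Num.sqrt 2]) gauss_fun x.

Definition phi y : R := (Num.sqrt pi * Num.sqrt 2)^-1 * expR (- (y ^+ 2 / 2)).

Lemma integrable_gauss (A : set R) : measurable A ->
  mu.-integrable A (EFin \o gauss_fun).
Proof.
move=> mA; apply: (integrableS _ _ _ integrableT_gauss) => //.
Qed.

Lemma sqrtpi_gt0 : 0 < Num.sqrt (pi : R).
Proof. by rewrite sqrtr_gt0 pi_gt0. Qed.

Lemma sqrt2_gt0 : 0 < Num.sqrt (2 : R).
Proof. by rewrite sqrtr_gt0. Qed.

Lemma RintegralT_gauss : \int[mu]_(x in setT) gauss_fun x = Num.sqrt (pi : R).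
Proof. by rewrite /Rintegral integralT_gauss. Qed.

(** The two half-line integrals add up to [sqrt pi]. The definition keeps the moving endpoint on the
    right for the fundamental theorem of calculus; this form gives positivity and the link to
    [gauss_tail]. *)
Lemma Psi_tail y :
  Psi y = (Num.sqrt pi)^-1 * \int[mu]_(x in `[y / Num.sqrt 2, +oo[) gauss_fun x.
Proof.
have s0 := sqrtpi_gt0.
set z := y / _.
have : \int[mu]_(x in setT) gauss_fun x =
    \int[mu]_(x in `]-oo, z]) gauss_fun x +
    \int[mu]_(x in `]z, +oo[) gauss_fun x.
  rewrite -Rintegral_setU//=.
  - congr Rintegral; apply/seteqP; split => // u _ /=.
    by rewrite !in_itv/= andbT; case: leP => ?; [left|right].
  - have -> : `]-oo, z] `|` `]z, +oo[ = [set: R].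
      apply/seteqP; split => // u _ /=.
      by rewrite !in_itv/= andbT; case: leP => ?; [left|right].
    exact: integrableT_gauss.
  - apply/disj_setPS => u /= []; rewrite !in_itv/= andbT => ? ?; lra.
rewrite RintegralT_gauss Rintegral_itv_obnd_cbnd; last first.
  exact: integrable_gauss.
move=> h; rewrite /Psi -/z.
apply: (mulfI (lt0r_neq0 s0)); rewrite mulrBr mulr1 !mulrA divff ?gt_eqF// !mul1r.
by rewrite {1}h addrC addKr.
Qed.

Lemma Psi_sqrt (g : R) : 0 <= g ->
  Psi (Num.sqrt (2 * g)) = 1 / Num.sqrt pi * gauss_tail g.
Proof.
move=> g0; rewrite Psi_tail sqrtrM// mulrAC divff ?gt_eqF ?sqrt2_gt0//.
by rewrite !mul1r.
Qed.

Lemma Psi0 : Psi 0 = 1 / 2.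
Proof.
rewrite Psi_tail mul0r /Rintegral integral0y_gauss /=.
by rewrite mulrA mulVf ?gt_eqF ?sqrtpi_gt0.
Qed.

Lemma Psi_ge0 y : 0 <= Psi y.
Proof.
rewrite Psi_tail mulr_ge0 ?invr_ge0 ?sqrtr_ge0//.
by apply: Rintegral_ge0 => x _; exact: gauss_fun_ge0.
Qed.

Lemma Psi_le1 y : Psi y <= 1.
Proof.
rewrite /Psi gerBl mulr_ge0 ?invr_ge0 ?sqrtr_ge0//.
by apply: Rintegral_ge0 => x _; exact: gauss_fun_ge0.
Qed.

Lemma is_derive_Psi y : is_derive y 1 Psi (- phi y).
Proof.
pose G (z : R) := \int[mu]_(x in `]-oo, z]) gauss_fun x.
have dG (z : R) : is_derive z 1 G (gauss_fun z).
  have [||||dG Gz] := @continuous_FTC1 R gauss_fun -oo%O z (z + 1).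
  - by rewrite ltrDl.
  - exact: integrable_gauss.
  - by rewrite ltNyr.
  - exact: continuous_gauss_fun.
  - by apply: DeriveDef; [exact: dG|rewrite -derive1E; exact: Gz].
have -> : Psi = cst 1 - ((Num.sqrt pi)^-1 \*: (G \o ((Num.sqrt 2)^-1 \*: id))).
  apply/funext => z; rewrite /Psi !fctE /G /=; congr (_ - _ * _).
  by rewrite mulrC.
apply: is_derive_eq.
rewrite /phi /gauss_fun /GRing.scale/= exprMn exprVn sqr_sqrtr// sub0r invfM.
rewrite mulr1 mulrA mulrAC; congr (- (_ * expR (- _))).
by rewrite mulrC.
Qed.

Lemma is_derive_phi y : is_derive y 1 phi (- (y * phi y)).
Proof.
have -> : phi = (Num.sqrt pi * Num.sqrt 2)^-1 \*:
   ((expR : R -> R) \o (- (2^-1 \*: (id ^+ 2)))).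
  apply/funext => z; rewrite /phi !fctE /=; congr (_ * expR (- _)).
  by rewrite mulrC.
apply: is_derive_eq.
rewrite /GRing.scale/= !fctE /GRing.scale/= mulr1 expr1.
by rewrite mulKf ?pnatr_eq0// !mulrN [y * _]mulrC mulrA.
Qed.

Lemma phi_ge0 y : 0 <= phi y.
Proof. by rewrite mulr_ge0 ?expR_ge0// invr_ge0 mulr_ge0// sqrtr_ge0. Qed.

Lemma expR_mul_sqr_le y : (1 + y ^+ 2 / 4) ^+ 2 * expR (- (y ^+ 2 / 2)) <= 1.
Proof.
have -> : y ^+ 2 / 2 = y ^+ 2 / 4 + y ^+ 2 / 4 by field.
rewrite expRN ler_pdivrMr ?expR_gt0// mul1r expRD -expr2.
rewrite lerXn2r ?nnegrE ?expR_ge0 ?expR_ge1Dx//.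
by have := sqr_ge0 y; lra.
Qed.

(** A single bound from which the later bounds on powers of [y] times [phi y] follow by comparing
    polynomials. *)
Lemma phi_quartic_le y : (1 + y ^+ 2 / 4) ^+ 2 * phi y <= 1.
Proof.
apply: le_trans (expR_mul_sqr_le y); rewrite ler_wpM2l ?sqr_ge0//.
rewrite /phi ler_piMl ?expR_ge0// invf_le1; last first.
  by rewrite mulr_gt0 ?sqrtpi_gt0 ?sqrt2_gt0.
rewrite -[leLHS]mulr1 ler_pM// -[leLHS]sqrtr1 ler_sqrt ?pi_ge0//; last by lra.
by have := pi_ge2 R; lra.
Qed.
End gaussian.

(** * Taylor bounds for [Psi], uniform in the base point *)

Section taylor.
Context {R : realType}.
Implicit Types x y k : R.

Lemma is_derive_continuous (f df : R -> R) :
  (forall x, is_derive x 1 f (df x)) -> continuous f.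
Proof.
move=> d x; apply/differentiable_continuous/derivable1_diffP.
exact: (@ex_derive _ _ _ _ _ _ _ (d x)).
Qed.

Lemma MVT_bound (f df : R -> R) (a b M : R) :
  (forall x, is_derive x 1 f (df x)) ->
  (forall x, Num.min a b <= x <= Num.max a b -> `|df x| <= M) ->
  `|f b - f a| <= M * `|b - a|.
Proof.
move=> d; wlog ab : a b / a <= b => [hw|] Mle.
  have [/hw|/ltW ba] := leP a b; first exact.
  by rewrite distrC [`|b - a|]distrC; apply: hw => //; rewrite minC maxC.
have [c cab ->] := @MVT_segment _ f df a b ab (fun x _ => d x)
  (continuous_subspaceT (is_derive_continuous _ _ d)).
rewrite normrM ler_wpM2r// Mle// (min_idPl ab) (max_idPr ab).
by move: cab; rewrite in_itv.
Qed.

(** Mean value theorem between 0 and [k]. The factor [1 / n.+1] of an integral is given up, since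
    only the order matters. *)
Lemma derivative_growth (f df : R -> R) (M k : R) n : 0 <= M ->
  (forall x, is_derive x 1 f (df x)) -> f 0 = 0 ->
  (forall x, `|df x| <= M * `|x| ^+ n) -> `|f k| <= M * `|k| ^+ n.+1.
Proof.
move=> M0 d f0 dM.
have := @MVT_bound f df 0 k (M * `|k| ^+ n) d.
rewrite f0 !subr0 exprSr mulrA; apply => x xk.
apply: (le_trans (dM x)); rewrite ler_wpM2l// lerXn2r ?nnegrE//.
move: xk; have [k0|k0] := leP 0 k => xk.
  by rewrite !ger0_norm; lra.
by rewrite !ler0_norm; lra.
Qed.

Lemma norm_phi_le y : `|phi y| <= 1.
Proof.
rewrite ger0_norm ?phi_ge0//.
have := phi_ge0 y; have := phi_quartic_le y; have := sqr_ge0 (y ^+ 2).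
by have := sqr_ge0 y; nra.
Qed.

Lemma norm_xphi_le y : `|y * phi y| <= 1.
Proof.
apply: le_trans (phi_quartic_le y).
rewrite normrM (ger0_norm (phi_ge0 y)) ler_wpM2r ?phi_ge0//.
rewrite -(real_normK (num_real y)); have := normr_ge0 y.
set u := `|y|; nra.
Qed.

Lemma norm_x3phi_le y : `|y ^+ 3 * phi y| <= 8.
Proof.
rewrite -[8]mulr1; apply: le_trans (ler_wpM2l _ (phi_quartic_le y)) => //.
rewrite [leRHS]mulrA normrM (ger0_norm (phi_ge0 y)) ler_wpM2r ?phi_ge0//.
rewrite normrX -(real_normK (num_real y)); have := normr_ge0 y.
set u := `|y| => u0.
have := mulr_ge0 u0 u0; have := sqr_ge0 (u * (u - 2)); rewrite !exprS expr0; nra.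
Qed.

Lemma norm_derive_xphi_le y : `|phi y - y ^+ 2 * phi y| <= 4.
Proof.
rewrite -[4]mulr1; apply: le_trans (ler_wpM2l _ (phi_quartic_le y)) => //.
rewrite -{1}[phi y]mul1r -mulrBl [leRHS]mulrA normrM (ger0_norm (phi_ge0 y)).
rewrite ler_wpM2r ?phi_ge0// ler_norml.
by have := sqr_ge0 y; have := sqr_ge0 (y ^+ 2); nra.
Qed.

Lemma is_derive_comp_addr (f : R -> R) (d y k : R) :
  is_derive (y + k) 1 f d -> is_derive k 1 (fun x => f (y + x)) d.
Proof.
move=> df; have dy : is_derive k 1 (cst y + id) (1 : R).
  by apply: is_derive_eq; rewrite add0r.
have := @is_derive1_comp _ f (cst y + id) k d 1 df dy.
by rewrite mulr1.
Qed.

Lemma is_derive_xphi y : is_derive y 1 (fun x => x * phi x) (phi y - y ^+ 2 * phi y).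
Proof.
have h := @is_deriveM _ _ id phi y 1 _ _ (is_derive_id _ _) (is_derive_phi y).
apply: (is_derive_eq h); rewrite /GRing.scale/=; ring.
Qed.

Lemma xphi_lipschitz x y : `|x * phi x - y * phi y| <= 4 * `|x - y|.
Proof.
apply: (@MVT_bound (fun x => x * phi x) (fun y => phi y - y ^+ 2 * phi y)).
  exact: is_derive_xphi.
by move=> z _; exact: norm_derive_xphi_le.
Qed.

Lemma Psi_lipschitz x y : `|Psi x - Psi y| <= `|x - y|.
Proof.
rewrite -[leRHS]mul1r; apply: (@MVT_bound Psi (fun y => - phi y)).
  exact: is_derive_Psi.
by move=> z _; rewrite normrN norm_phi_le.
Qed.

Lemma Psi_decr : {homo @Psi R : x y /~ x <= y}.
Proof.
move=> y x xy; have [c _ h] := @MVT_segment _ Psi (fun y => - phi y) x y xy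
  (fun x _ => is_derive_Psi x)
  (continuous_subspaceT (is_derive_continuous _ _ (@is_derive_Psi R))).
by rewrite -subr_le0 h mulNr oppr_le0 mulr_ge0 ?phi_ge0// subr_ge0.
Qed.

(** The second derivative [y * phi y] of [Psi] is 4-Lipschitz, which bounds [D2]; two uses of
    [derivative_growth] pass from [D2] to [D1] and on to the remainder [D0]. *)
Lemma Psi_taylor y k :
  `|Psi (y + k) - Psi y + k * phi y - k ^+ 2 / 2 * (y * phi y)| <= 4 * `|k| ^+ 3.
Proof.
pose D1 (x : R) := - phi (y + x) + phi y - x * (y * phi y).
pose D2 (x : R) := (y + x) * phi (y + x) - y * phi y.
have dpsi (x : R) := is_derive_comp_addr _ _ _ _ (is_derive_Psi (y + x)).
have dphi (x : R) := is_derive_comp_addr _ _ _ _ (is_derive_phi (y + x)).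
have D2le (x : R) : `|D2 x| <= 4 * `|x| ^+ 1.
  apply: le_trans (xphi_lipschitz _ _) _.
  by rewrite expr1 addrC addKr.
have D1le (x : R) : `|D1 x| <= 4 * `|x| ^+ 2.
  apply: (@derivative_growth D1 D2) => // [z|]; last first.
    by rewrite /D1 addr0 mul0r subr0 addNr.
  have -> : D1 = - (fun x => phi (y + x)) + cst (phi y) - (id * cst (y * phi y)).
    by [].
  have := dphi z => dz.
  apply: is_derive_eq; rewrite /GRing.scale/= /D2; ring.
pose D0 (x : R) := Psi (y + x) - Psi y + x * phi y - x ^+ 2 / 2 * (y * phi y).
apply: (@derivative_growth D0 D1) => // [z|]; last first.
  by rewrite /D0 addr0 subrr expr0n/= !mul0r subr0 addr0.
have -> : D0 = (fun x => Psi (y + x)) - cst (Psi y) + (id * cst (phi y)) -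
    ((id ^+ 2) * cst (2^-1 * (y * phi y))).
  by apply/funext => u; rewrite /D0 !fctE /= -!mulrA.
have := dpsi z => dz.
apply: is_derive_eq; rewrite /GRing.scale/= /D1 expr1.
by move: (phi (y + z)) (phi y) => u v; field.
Qed.

(** [Psi (- y) + Psi y] has derivative 0, [phi] being even, and equals 1 at 0. *)
Lemma PsiN y : Psi (- y) = 1 - Psi y.
Proof.
have d (x : R) : is_derive x 1 (Psi \o -%R + Psi) (0 : R).
  have := is_derive_Psi (- x); have := is_derive_Psi x => h1 h2.
  have h3 := @is_derive1_comp _ Psi -%R x _ _ h2 (is_deriveNid _ _).
  apply: is_derive_eq.
  by rewrite /phi sqrrN mulrN1 opprK subrr.
have := @is_derive_0_is_cst _ _ y 0 d.
by rewrite !fctE /= oppr0 Psi0 => h; lra.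
Qed.

End taylor.

(** * Decay of the normal tail *)

Section tail.
Context {R : realType}.
Implicit Types x y z : R.

Let mu := @lebesgue_measure R.

Lemma integral_xgauss z : 0 < z ->
  (\int[mu]_(x in `[z, +oo[) (z^-1 * (x * gauss_fun x))%:E =
    ((2 * z)^-1 * gauss_fun z)%:E)%E.
Proof.
move=> z0.
pose F x := - (2 * z)^-1 * gauss_fun x.
have dF x : is_derive x 1 F (z^-1 * (x * gauss_fun x)).
  have -> : F = (- (2 * z)^-1) \*: ((expR : R -> R) \o (- (id ^+ 2))) by [].
  apply: is_derive_eq; rewrite /gauss_fun /GRing.scale/= expr1 !fctE.
  by field; rewrite gt_eqF.
have cg : continuous (fun x : R => z^-1 * (x * gauss_fun x)).
  move=> x; apply: cvgMl_tmp; apply: cvgM; first exact: cvg_id.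
  exact: continuous_gauss_fun.
rewrite (@ge0_continuous_FTC2y R _ F z 0).
- by rewrite -EFinB /F mulNr opprK add0r.
- move=> x zx; rewrite mulr_ge0 ?invr_ge0 ?mulr_ge0 ?gauss_fun_ge0//; lra.
- exact: continuous_subspaceT.
- rewrite -[X in _ --> X](mulr0 (- (2 * z)^-1)).
  by apply: cvgMl_tmp; exact: cvg_gauss_fun.
- by move=> x _; exact: (@ex_derive _ _ _ _ _ _ _ (dF x)).
- by apply: cvg_at_right_filter; exact: (is_derive_continuous _ _ dF).
- by move=> x _; rewrite derive1E; exact: (@derive_val _ _ _ _ _ _ _ (dF x)).
Qed.

(** For [x >= z] the integrand is at most [x / z] times itself, which has an explicit primitive; its
    Gaussian factor is then dropped. *)
Lemma Psi_le_inv y : 0 < y -> Psi y <= y^-1.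
Proof.
move=> y0; rewrite Psi_tail.
set z := y / Num.sqrt 2.
have z0 : 0 < z by rewrite divr_gt0 ?sqrt2_gt0.
have le : (\int[mu]_(x in `[z, +oo[) (gauss_fun x)%:E <= ((2 * z)^-1 * gauss_fun z)%:E)%E.
  rewrite -integral_xgauss//; apply: ge0_le_integral => //=.
  - by move=> x _; rewrite lee_fin gauss_fun_ge0.
  - exact: (measurable_int mu (integrable_gauss _ (measurable_itv _))).
  - apply/measurable_EFinP; apply: measurable_funTS.
    apply: continuous_measurable_fun => x; apply: cvgMl_tmp.
    by apply: cvgM; [exact: cvg_id|exact: continuous_gauss_fun].
  - move=> x; rewrite in_itv/= andbT => zx.
    rewrite lee_fin mulrA ler_peMl ?gauss_fun_ge0//.
    by rewrite mulrC ler_pdivlMr ?mul1r.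
have int_le : \int[mu]_(x in `[z, +oo[) gauss_fun x <= (2 * z)^-1.
  apply: (@le_trans _ _ ((2 * z)^-1 * gauss_fun z)); last first.
    by rewrite ler_piMr ?gauss_fun_le1// invr_ge0; lra.
  rewrite -lee_fin /Rintegral fineK//.
  apply: integrable_fin_num => //; exact: integrable_gauss.
apply: (@le_trans _ _ ((Num.sqrt pi)^-1 * (2 * z)^-1)).
  by rewrite ler_wpM2l// invr_ge0 sqrtr_ge0.
have s2 : Num.sqrt (2 : R) ^+ 2 = 2 by rewrite sqr_sqrtr.
have sp : Num.sqrt (pi : R) ^+ 2 = pi by rewrite sqr_sqrtr ?pi_ge0.
have s0 := @sqrt2_gt0 R; have p0 := @sqrtpi_gt0 R.
have p1 : 1 <= Num.sqrt (pi : R).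
  by rewrite -[leLHS]sqrtr1 ler_sqrt ?pi_ge0//; have := pi_ge2 R; lra.
rewrite -invfM lef_pV2 ?posrE ?mulr_gt0//.
have -> : 2 * z = Num.sqrt 2 * y by rewrite -{1}s2 /z; field; rewrite gt_eqF.
rewrite mulrA ler_peMl; first by lra.
  exact: ltW.
by nra.
Qed.

End tail.

(** * The heat potential *)

Section heat.
Context {R : realType}.
Implicit Types x y z a d r t : R.

(** Expanding in the ratio [u], not in the displacement [y * u], leaves a second derivative
    controlled by the bounded function [y ^+ 3 * phi y], so the error is uniform in [y]. *)
Lemma Psi_dilation y u : 0 <= u <= 1 / 2 ->
  `|Psi (y * (1 - u)) - Psi y - u * (y * phi y)| <= 32 * u ^+ 2.
Proof.
move=> /andP[u0 u1].
have dscale (t : R) : is_derive t 1 (cst y * (cst 1 - id)) (- y).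
  by apply: is_derive_eq; rewrite /GRing.scale/=; ring.
have dpsi (t : R) : is_derive t 1 (fun t => Psi (y * (1 - t))) (y * phi (y * (1 - t))).
  have h := @is_derive1_comp _ Psi _ t _ _ (is_derive_Psi (y * (1 - t))) (dscale t).
  by apply: (is_derive_eq h); rewrite mulrNN mulrC.
have dphi (t : R) : is_derive t 1 (fun t => y * phi (y * (1 - t)))
    (y ^+ 3 * (1 - t) * phi (y * (1 - t))).
  have h := @is_derive1_comp _ phi _ t _ _ (is_derive_phi (y * (1 - t))) (dscale t).
  have {}h := @is_deriveZ _ _ _ _ y _ _ _ h.
  by apply: (is_derive_eq h); rewrite /GRing.scale/=; ring.
have d1le (t : R) : 0 <= t <= u -> `|y * phi (y * (1 - t)) - y * phi y| <= 32 * u.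
  move=> /andP[t0 tu].
  have := @MVT_bound _ _ _ 0 t 32 dphi; rewrite !subr0 mulr1 => h.
  apply: le_trans (h _) _; last by rewrite ger0_norm//; lra.
  move=> s; rewrite (min_idPl t0) (max_idPr t0) => /andP[s0 st].
  (* The cube of the rescaled argument times [phi] is at most 8, and [1 - s >= 1 / 2] costs a factor
     4; hence 32. *)
  have -> : y ^+ 3 * (1 - s) * phi (y * (1 - s)) =
     ((y * (1 - s)) ^+ 3 * phi (y * (1 - s))) / (1 - s) ^+ 2.
    by field; lra.
  rewrite normrM normfV (@ger0_norm _ ((1 - s) ^+ 2)) ?sqr_ge0//.
  rewrite ler_pdivrMr ?exprn_gt0//; last by lra.
  apply: le_trans (norm_x3phi_le _) _; rewrite expr2; nra.
have h := @MVT_bound _ (fun t => Psi (y * (1 - t)) - t * (y * phi y))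
  (fun t => y * phi (y * (1 - t)) - y * phi y) 0 u (32 * u).
rewrite !subr0 mulr1 mul0r subr0 (ger0_norm u0) -mulrA -expr2 in h.
have -> : Psi (y * (1 - u)) - Psi y - u * (y * phi y) =
  Psi (y * (1 - u)) - u * (y * phi y) - Psi y by ring.
apply: h => [t|t]; last by rewrite (min_idPl u0) (max_idPr u0); exact: d1le.
have -> : (fun t => Psi (y * (1 - t)) - t * (y * phi y)) =
  (fun t => Psi (y * (1 - t))) - (id * cst (y * phi y)) by [].
have := dpsi t => dt.
by apply: is_derive_eq; rewrite /GRing.scale/=; ring.
Qed.

(* [heat x a] solves the heat equation [heat_a = heat_xx / 2]; its derivatives
   in [x] are [- slope] and [curv]. *)
Definition heat x a := Psi (x / Num.sqrt a).
Definition slope x a := phi (x / Num.sqrt a) / Num.sqrt a.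
Definition curv x a := x / Num.sqrt a * phi (x / Num.sqrt a) / a.

(** Advancing the clock multiplies [x / sqrt a] by [1 - u], where [u] is [1 / (2 a)] up to
    [1 / a ^+ 2]; the first-order term of [Psi_dilation] is then half the curvature. *)
Lemma heat_time x a : 1 <= a ->
  `|heat x (a + 1) - heat x a - curv x a / 2| <= 34 / Num.sqrt a ^+ 3.
Proof.
move=> a1; rewrite /heat /curv.
have : Num.sqrt (a + 1) ^+ 2 = Num.sqrt a ^+ 2 + 1 by rewrite !sqr_sqrtr//; lra.
have : Num.sqrt a ^+ 2 = a by rewrite sqr_sqrtr//; lra.
have : 1 <= Num.sqrt a by rewrite -[leLHS]sqrtr1 ler_sqrt//; lra.
have : 0 <= Num.sqrt (a + 1) by rewrite sqrtr_ge0.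
set r := Num.sqrt a; set s := Num.sqrt (a + 1) => s0 r1 <- sr.
have rs : r < s by rewrite -(ltr_pXn2r (ltn0Sn 1)) ?nnegrE; lra.
set y := x / r.
pose u := (s - r) / s.
have -> : x / s = y * (1 - u) by rewrite /y /u; field; lra.
have uE : u = (s * (s + r))^-1.
  rewrite /u; have : (s - r) * (s + r) = 1 by rewrite -subr_sqr sr; ring.
  move=> h; apply: (mulIf (_ : s * (s + r) != 0)); first nra.
  rewrite mulVf; last by nra.
  by rewrite -{}h; field; lra.
have u0 : 0 <= u by rewrite divr_ge0//; lra.
have ur : u <= (r ^+ 2)^-1.
  by rewrite uE lef_pV2 ?posrE ?exprn_gt0//; nra.
have u2 : u <= 1 / 2.
  by rewrite uE div1r lef_pV2 ?posrE; nra.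
have hu : `|u - (r ^+ 2)^-1 / 2| <= (r ^+ 4)^-1.
  have -> : u - (r ^+ 2)^-1 / 2 =
      - (2 * r + s) / ((s + r) * (2 * r ^+ 2 * (s * (s + r)))).
    rewrite uE; have : (s - r) * (s + r) = 1 by rewrite -subr_sqr sr; ring.
    move=> h; have -> : 2 * r + s = (s - r) * (s + r) * (2 * r + s) by rewrite h mul1r.
    by field; lra.
  have sr0 : 0 < s + r by lra.
  have ssr0 : 0 < s * (s + r) by rewrite mulr_gt0//; lra.
  have den : 0 < (s + r) * (2 * r ^+ 2 * (s * (s + r))).
    by rewrite !mulr_gt0// ?exprn_gt0//; lra.
  rewrite normrM normrN normfV (gtr0_norm den) ger0_norm; last by lra.
  rewrite ler_pdivrMr//.
  rewrite [leRHS]mulrC ler_pdivlMr ?exprn_gt0//; last lra.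
  have : r ^+ 2 <= s * (s + r) by nra.
  have : 2 * r + s <= (s + r) * 2 by nra.
  have := sqr_ge0 r.
  move=> h1 h2 h3.
  have : (2 * r + s) * r ^+ 2 <= (s + r) * 2 * (s * (s + r)) by apply: ler_pM => //; lra.
  rewrite -[4%N]/(2 + 2)%N exprD => h4; nra.
have h1 := @Psi_dilation y u.
have h2 := norm_xphi_le y.
have -> : Psi (y * (1 - u)) - Psi y - y * phi y / r ^+ 2 / 2 =
   (Psi (y * (1 - u)) - Psi y - u * (y * phi y)) + (u - (r ^+ 2)^-1 / 2) * (y * phi y).
  by ring.
apply: le_trans (ler_normD _ _) _; rewrite normrM.
have h3 : u ^+ 2 <= (r ^+ 4)^-1.
  by rewrite -[4%N]/(2 * 2)%N exprM -exprVn lerXn2r ?nnegrE ?invr_ge0 ?sqr_ge0.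
have h4 : (r ^+ 4)^-1 <= (r ^+ 3)^-1.
  by rewrite lef_pV2 ?posrE ?exprn_gt0 ?(lt_le_trans ltr01)// ler_weXn2l.
have h5 : 0 <= (r ^+ 4)^-1 by rewrite invr_ge0 exprn_ge0//; lra.
have := h1; rewrite u0 u2 => /(_ isT).
have := ler_pM (normr_ge0 _) (normr_ge0 _) hu h2.
by lra.
Qed.

Lemma sqrt_ge1 a : 1 <= a -> 1 <= Num.sqrt a.
Proof. by move=> a1; rewrite -[leLHS]sqrtr1 ler_sqrt//; lra. Qed.

Lemma heat_taylor x z a : 1 <= a -> `|z| <= 1 ->
  `|heat (x + z) a - heat x a + z * slope x a - z ^+ 2 / 2 * curv x a|
    <= 4 / Num.sqrt a ^+ 3.
Proof.
move=> a1 z1; have r1 := sqrt_ge1 _ a1; rewrite /heat /slope /curv.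
have : Num.sqrt a ^+ 2 = a by rewrite sqr_sqrtr//; lra.
move: r1; set r := Num.sqrt a => r1 ra; rewrite -{}ra.
have := Psi_taylor (x / r) (z / r).
have -> : Psi ((x + z) / r) = Psi (x / r + z / r) by rewrite mulrDl.
have -> : z * (phi (x / r) / r) = z / r * phi (x / r) by ring.
have -> : z ^+ 2 / 2 * (x / r * phi (x / r) / r ^+ 2) =
    (z / r) ^+ 2 / 2 * (x / r * phi (x / r)).
  by field; lra.
move=> h; apply: (le_trans h); rewrite ler_wpM2l//.
rewrite normrM exprMn normfV (@ger0_norm _ r); last by lra.
rewrite -exprVn ler_piMl ?exprn_ge0 ?invr_ge0//; first by lra.
by rewrite exprn_ile1.
Qed.

Lemma norm_curv_le x a : 1 <= a -> `|curv x a| <= a^-1.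
Proof.
move=> a1; rewrite normrM normfV (@ger0_norm _ a); last by lra.
by rewrite ler_piMl ?norm_xphi_le// invr_ge0; lra.
Qed.

(** Sharper than [norm_curv_le] near 0: for bounded [x] the curvature is no larger in order than the
    Taylor remainder. It serves [min (1, 2 v)] near its kink. *)
Lemma norm_curv_le_abs x a : 1 <= a -> `|curv x a| <= `|x| / Num.sqrt a ^+ 3.
Proof.
move=> a1; have r1 := sqrt_ge1 _ a1; rewrite /curv.
have : Num.sqrt a ^+ 2 = a by rewrite sqr_sqrtr//; lra.
move: r1; set r := Num.sqrt a => r1 ra; rewrite -{}ra.
have -> : x / r * phi (x / r) / r ^+ 2 = phi (x / r) * (x / r ^+ 3) by field; lra.
rewrite normrM [X in _ * X]normrM normfV (@ger0_norm _ (r ^+ 3)); last first.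
  by rewrite exprn_ge0//; lra.
rewrite ler_piMl ?norm_phi_le// divr_ge0// exprn_ge0//; lra.
Qed.

Lemma curv_ge0 x a : 0 <= x -> 0 <= a -> 0 <= curv x a.
Proof.
by move=> x0 a0; rewrite /curv !mulr_ge0 ?phi_ge0 ?invr_ge0 ?sqrtr_ge0.
Qed.

Lemma curv_lipschitz x d a : 1 <= a -> `|d| <= 1 ->
  `|curv (x + d) a - curv x a| <= 4 / Num.sqrt a ^+ 3.
Proof.
move=> a1 d1; have r1 := sqrt_ge1 _ a1; rewrite /curv.
have : Num.sqrt a ^+ 2 = a by rewrite sqr_sqrtr//; lra.
move: r1; set r := Num.sqrt a => r1 ra; rewrite -{}ra.
rewrite -mulrBl normrM normfV (@ger0_norm _ (r ^+ 2)) ?sqr_ge0//.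
have h := xphi_lipschitz ((x + d) / r) (x / r).
rewrite ler_pdivrMr ?exprn_gt0//; last by lra.
apply: le_trans h _; rewrite exprS invfM.
have -> : 4 * (r^-1 / r ^+ 2) * r ^+ 2 = 4 * r^-1 by field; lra.
rewrite ler_wpM2l// -mulrBl addrAC subrr add0r normrM normfV.
rewrite (@ger0_norm _ r); last by lra.
by rewrite ler_piMl// invr_ge0; lra.
Qed.

(* The weights pay for the first-order term; at second order [z ^+ 2 = 1] matches
   the heat equation up to [d ^+ 2]. *)
Lemma heat_step x z d a : 1 <= a -> `|z| <= 1 -> `|d| <= 1 ->
  `|heat (x + z) a + (z - d) * slope x a - heat (x + d) (a + 1)
     - (z ^+ 2 - 1 - d ^+ 2) / 2 * curv x a| <= 44 / Num.sqrt a ^+ 3.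
Proof.
move=> a1 z1 d1.
have hz := heat_taylor x _ _ a1 z1; have hd := heat_taylor x _ _ a1 d1.
have ht := heat_time (x + d) _ a1; have hc := curv_lipschitz x _ _ a1 d1.
set ez := heat (x + z) a - _ + _ - _ in hz.
set ed := heat (x + d) a - _ + _ - _ in hd.
set et := heat (x + d) (a + 1) - _ - _ in ht.
set ec := curv (x + d) a - _ in hc.
(* Two space expansions, the clock step and the displacement of the curvature give
   [4 + 4 + 34 + 2 = 44]. *)
set e := (X in `|X| <= _); have -> : e = ez - ed - et - ec / 2.
  rewrite /e /ez /ed /et /ec; move: (heat (x + z) a) (heat x a) (heat (x + d) a).
  move: (heat (x + d) (a + 1)) (slope x a) (curv x a) (curv (x + d) a) => *.
  by field.
apply: le_trans (ler_normB _ _) _.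
have := ler_normB (ez - ed) et; have := ler_normB ez ed.
have -> : `|ec / 2| = `|ec| / 2 by rewrite normrM (@ger0_norm _ 2^-1).
by lra.
Qed.

Lemma heat_ge0 x a : 0 <= heat x a. Proof. exact: Psi_ge0. Qed.

Lemma heat_le1 x a : heat x a <= 1. Proof. exact: Psi_le1. Qed.

Lemma heat_decr a : {homo (fun x => heat x a) : x y /~ x <= y}.
Proof. by move=> y x xy; rewrite /heat Psi_decr// ler_wpM2r// invr_ge0 sqrtr_ge0. Qed.

Lemma slope_ge0 x a : 0 <= slope x a.
Proof. by rewrite divr_ge0 ?phi_ge0 ?sqrtr_ge0. Qed.

Lemma is_derive_heat x a : is_derive x 1 (fun x => heat x a) (- slope x a).
Proof.
have ds : is_derive x 1 (id * cst (Num.sqrt a)^-1) (Num.sqrt a)^-1.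
  by apply: is_derive_eq; rewrite /GRing.scale/= mulr0 add0r mulr1.
have h := @is_derive1_comp _ Psi _ x _ _ (is_derive_Psi (x / Num.sqrt a)) ds.
by apply: (is_derive_eq h); rewrite mulNr.
Qed.

Lemma heat_start (x c T t : R) : 1 <= T -> 0 <= t -> 0 <= x ->
  `|heat (x * Num.sqrt T + c) (T + t) - Psi x| <= `|c| / Num.sqrt T + x * (t / T).
Proof.
move=> T1 t0 x0; apply: le_trans (Psi_lipschitz _ _) _.
have sT := sqrt_ge1 _ T1.
have : Num.sqrt T ^+ 2 = T by rewrite sqr_sqrtr//; lra.
have : Num.sqrt (T + t) ^+ 2 = T + t by rewrite sqr_sqrtr//; lra.
have sTt : Num.sqrt T <= Num.sqrt (T + t) by rewrite ler_sqrt//; lra.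
move: sT sTt; set r := Num.sqrt T; set s := Num.sqrt (T + t) => r1 rs s2 r2.
have -> : (x * r + c) / s - x = c / s - x * ((s - r) / s) by field; lra.
apply: le_trans (ler_normB _ _) _; apply: lerD.
  rewrite normrM normfV ler_wpM2l// (@ger0_norm _ s); last by lra.
  by rewrite lef_pV2 ?posrE; lra.
rewrite ger0_norm ?mulr_ge0 ?invr_ge0; try lra.
rewrite ler_wpM2l// ler_pdivrMr; last by lra.
have -> : t = (s - r) * (s + r) by rewrite -subr_sqr s2 r2; ring.
have h : 1 <= (s + r) * ((r ^+ 2)^-1 * s).
  rewrite mulrCA mulrC ler_pdivlMr ?exprn_gt0//; last by lra.
  by rewrite mul1r expr2 ler_pM; lra.
by rewrite -r2 -!mulrA ler_peMr ?subr_ge0.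
Qed.

(** Telescoping: consecutive roots [r < s] satisfy [1 / r - 1 / s = 1 / (r s (r + s))], and
    [s <= 2 r] makes this at least [1 / (6 r ^+ 3)]. *)
Lemma sum_inv_sqrt3 (t : R) (T : nat) : 1 <= t ->
  \sum_(m < T) (Num.sqrt (m%:R + t) ^+ 3)^-1 <= 6 / Num.sqrt t.
Proof.
move=> t1.
suff : \sum_(m < T) (Num.sqrt (m%:R + t) ^+ 3)^-1 <=
    6 * ((Num.sqrt t)^-1 - (Num.sqrt (T%:R + t))^-1).
  have : 0 <= (Num.sqrt (T%:R + t))^-1 by rewrite invr_ge0 sqrtr_ge0.
  by lra.
elim: T => [|T ih]; first by rewrite big_ord0 add0r subrr mulr0.
rewrite big_ord_recr /=.
suff : (Num.sqrt (T%:R + t) ^+ 3)^-1 <=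
    6 * ((Num.sqrt (T%:R + t))^-1 - (Num.sqrt (T.+1%:R + t))^-1) by lra.
have T0 : 0 <= T%:R :> R by [].
rewrite -(natr1 T).
have s1 : 1 <= Num.sqrt (T%:R + t) by apply: sqrt_ge1; lra.
have : Num.sqrt (T%:R + t) <= Num.sqrt (T%:R + 1 + t) by rewrite ler_sqrt; lra.
have : Num.sqrt (T%:R + 1 + t) ^+ 2 = Num.sqrt (T%:R + t) ^+ 2 + 1.
  by rewrite !sqr_sqrtr; lra.
move: s1; set r := Num.sqrt (T%:R + t); set s := Num.sqrt (T%:R + 1 + t) => r1 s2 rs.
have -> : r^-1 - s^-1 = (s ^+ 2 - r ^+ 2) / (r * s * (r + s)) by field; lra.
rewrite s2 addrAC subrr add0r mul1r -[leLHS]mulr1.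
have s2r : s <= 2 * r by nra.
have rs0 : 0 < r * s * (r + s) by rewrite !mulr_gt0//; lra.
rewrite mulrC ler_pdivrMr ?exprn_gt0//; last by lra.
rewrite mulrAC ler_pdivlMr// mul1r.
have : r * s <= r * (2 * r) by nra.
have : r + s <= 3 * r by lra.
move=> h1 h2; have := ler_pM _ _ h2 h1.
by rewrite !exprS expr0; nra.
Qed.

End heat.

(** * Rounding *)

Section rounding.
Context {R : realType}.

(** Motion along [(P2, - P1)] fixes the [P]-sum, and one of its two senses does not lower the
    [B]-sum; it stops at the boundary of the square. If some [P] vanishes, that coordinate can be
    set to 0, as [B <= 0]. *)
Lemma round_two (P1 P2 B1 B2 l1 l2 : R) :
  0 <= P1 -> 0 <= P2 -> 0 < l1 < 1 -> 0 < l2 < 1 -> B1 <= 0 -> B2 <= 0 ->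
  exists m1 m2 : R, [/\ 0 <= m1 <= 1, 0 <= m2 <= 1,
    [|| m1 == 0, m1 == 1, m2 == 0 | m2 == 1],
    P1 * l1 + P2 * l2 <= P1 * m1 + P2 * m2 &
    B1 * l1 + B2 * l2 <= B1 * m1 + B2 * m2].
Proof.
wlog BP : P1 P2 B1 B2 l1 l2 / P1 * B2 <= P2 * B1.
  move=> hw P10 P20 l1b l2b B10 B20.
  have [|/ltW] := leP (P1 * B2) (P2 * B1).
    by move=> h; exact: (hw _ _ _ _ _ _ h).
  move=> h; have [m2 [m1 [m2b m1b m01 hP hB]]] :=
    hw _ _ _ _ _ _ h P20 P10 l2b l1b B20 B10.
  exists m1, m2; split => //; try lra.
move=> P10 P20 /andP[l10 l11] /andP[l20 l21] B10 B20.
have [P20'|P20'] := eqVneq P2 0.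
  exists l1, 0; rewrite eqxx !orbT; split => //; try lra.
    by rewrite P20'; lra.
  by nra.
have [P10'|P10'] := eqVneq P1 0.
  exists 0, l2; rewrite eqxx; split => //; try lra.
    by rewrite P10'; lra.
  by nra.
have {P20'}P20 : 0 < P2 by rewrite lt_def P20'.
have {P10'}P10 : 0 < P1 by rewrite lt_def P10'.
(* These are the times at which the first coordinate reaches 1 and the second reaches 0; the earlier
   one is used. *)
have [h|h] := leP ((1 - l1) / P2) (l2 / P1).
  pose t := (1 - l1) / P2.
  have tP : P2 * t = 1 - l1 by rewrite /t; field; rewrite gt_eqF.
  have t0 : 0 <= t by rewrite divr_ge0; lra.
  have tle : P1 * t <= l2 by rewrite mulrC -ler_pdivlMr.
  have h2 : 0 <= (P2 * B1 - P1 * B2) * t by rewrite mulr_ge0// subr_ge0.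
  exists 1, (l2 - P1 * t); rewrite eqxx !orbT; split => //; try nra.
pose t := l2 / P1.
have tP : P1 * t = l2 by rewrite /t; field; rewrite gt_eqF.
have t0 : 0 <= t by rewrite divr_ge0; lra.
have tle : P2 * t <= 1 - l1 by rewrite mulrC -ler_pdivlMr// ltW.
have h2 : 0 <= (P2 * B1 - P1 * B2) * t by rewrite mulr_ge0// subr_ge0.
exists (l1 + P2 * t), 0; rewrite eqxx !orbT; split => //; try nra.
Qed.

(* A linear program with two constraints besides the box has an optimal vertex
   with at most one fractional coordinate, here rounded up. *)
Lemma round_all N (P B l : 'I_N -> R) :
  (forall i, 0 <= P i) -> (forall i, -1 <= B i <= 0) ->
  (forall i, 0 <= l i <= 1) ->
  exists c : 'I_N -> bool,
    \sum_i P i * l i <= \sum_i P i * (c i)%:R /\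
    \sum_i B i * l i - 1 <= \sum_i B i * (c i)%:R.
Proof.
move=> P0 B01.
have [n] := ubnP #|[set i | 0 < l i < 1]%SET|.
elim: n l => // n ih l ln l01.
have [/existsP[i /existsP[j /and3P[ij li lj]]]|none] :=
  boolP [exists i, [exists j, [&& i != j, 0 < l i < 1 & 0 < l j < 1]]].
  have [||mi [mj [mi01 mj01 mij hP hB]]] :=
    round_two (P i) (P j) (B i) (B j) (l i) (l j) (P0 i) (P0 j) li lj.
  - by have /andP[] := B01 i.
  - by have /andP[] := B01 j.
  pose m k := if k == i then mi else if k == j then mj else l k.
  have mii : m i = mi by rewrite /m eqxx.
  have mjj : m j = mj by rewrite /m eq_sym (negbTE ij) eqxx.
  have sumE (F : 'I_N -> R) (u : 'I_N -> R) : \sum_k F k * u k =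
      F i * u i + F j * u j + \sum_(k | (k != i) && (k != j)) F k * u k.
    by rewrite (bigD1 i)//= (bigD1 j)/= ?addrA// eq_sym.
  have rest (F : 'I_N -> R) : \sum_(k | (k != i) && (k != j)) F k * m k =
      \sum_(k | (k != i) && (k != j)) F k * l k.
    by apply: eq_bigr => k /andP[/negbTE ki /negbTE kj]; rewrite /m ki kj.
  have [||c [cP cB]] := ih m.
  - apply: (@leq_trans #|[set i | 0 < l i < 1]%SET|); last by rewrite -ltnS.
    apply: proper_card; apply/properP; split.
      apply/fintype.subsetP => k; rewrite !inE /m.
      by case: eqP => [->//|_]; case: eqP => [->//|_].
    case/or4P: mij => /eqP mE.
    + by exists i; rewrite !inE ?li// mii mE ltxx.
    + by exists i; rewrite !inE ?li// mii mE ltxx andbF.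
    + by exists j; rewrite !inE ?lj// mjj mE ltxx.
    + by exists j; rewrite !inE ?lj// mjj mE ltxx andbF.
  - by move=> k; rewrite /m; case: eqP => // _; case: eqP.
  exists c; split.
    by apply: le_trans cP; rewrite (sumE P l) (sumE P m) rest mii mjj; lra.
  by apply: le_trans cB; rewrite (sumE B l) (sumE B m) rest mii mjj; lra.
(* At most one fractional coordinate is left. Raising it to 1 cannot lower the [P]-sum and costs the
   [B]-sum at most 1, since [-1 <= B i]. *)
exists (fun i => 0 < l i); split.
  apply: ler_sum => i _; rewrite ler_wpM2l//.
  by have := l01 i; case: ltP; rewrite /=; lra.
have integral j : ~~ (0 < l j < 1) -> B j * l j <= B j * (0 < l j)%R%:R.
  have := l01 j; case: (ltP 0 (l j)) => /= hl; rewrite ?mulr1 ?mulr0.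
    by rewrite -leNgt => h1 h2; rewrite (_ : l j = 1) ?mulr1//; lra.
  by move=> h1 _; rewrite (_ : l j = 0) ?mulr0//; lra.
have [/existsP[i li]|none1] := boolP [exists i, 0 < l i < 1]; last first.
  rewrite lerBlDr -[leLHS]addr0 lerD//; apply: ler_sum => i _.
  by apply: integral; move: none1; rewrite negb_exists => /forallP.
rewrite (bigD1 i)//= [leRHS](bigD1 i)//= addrAC lerD//.
  by have := B01 i; have /andP[-> ?] := li; rewrite /= mulr1; nra.
apply: ler_sum => j ji; apply: integral.
apply: contra none => lj; apply/existsP; exists i; apply/existsP; exists j.
by rewrite eq_sym ji li.
Qed.

End rounding.

(** * Potentials and drifting games *)

Section games.
Context {R : realType}.

Definition chip_weight (f : R -> int -> R) (t : int) (x : R) : R :=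
  if `[< derivable (f^~ t) x 1 >] then - 'D_1 (f^~ t) x else 0.

(** Shifting coordinate [i] changes only the [i]-th summand of [Lambda], so later inequalities can
    be stated for one chip. *)
Lemma weightsE N (f : R -> int -> R) (s : 'rV[R]_N) t i :
  weights f s t 0 i = N%:R^-1 * chip_weight f t (s 0 i).
Proof.
rewrite mxE /chip_weight; case: asboolP => [df|_]; last by rewrite mulr0.
rewrite mulrN; congr (- _); rewrite /derive.
have -> : (fun h : R => h^-1 *: (((fun u => Lambda f u t) \o shift s)
      (h *: delta_mx 0 i) - Lambda f s t)) =
    N%:R^-1 \*: (fun h : R => h^-1 *: ((f^~ t \o shift (s 0 i)) (h *: 1) - f (s 0 i) t)).
  apply/funext => h /=.
  have scaleE (a b : R) : a *: b = a * b by [].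
  rewrite /Lambda -mulrBr !scaleE mulrCA -sumrB (bigD1 i)//= big1 ?addr0; last first.
    by move=> j ji; rewrite !mxE (negbTE ji) mulr0 add0r subrr.
  by rewrite !mxE !eqxx.
exact: (@limZl_tmp _ _ _ _ _ (N%:R^-1 : R) _ df).
Qed.

Lemma natr_mul_sum N (c : R) : N%:R * c = \sum_(i < N) c.
Proof. by rewrite sumr_const card_ord mulr_natl. Qed.

Lemma positions_rcons N (h : history R N) r :
  positions (rcons h r) = positions h + r.2.
Proof. by rewrite /positions -cats1 big_cat big_seq1. Qed.

Lemma size_play N (sigma : history R N -> 'rV[R]_N) tau k :
  size (play sigma tau k) = k.
Proof. by elim: k => //= k ih; rewrite size_rcons ih. Qed.

Lemma exists_potential_strategy N T (f : R -> int -> R) : (0 < N)%N ->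
  (forall m x, (m < T)%N -> 0 <= chip_weight f (- m%:Z) x) ->
  exists sigma : history R N -> 'rV[R]_N,
    player_strategy sigma /\ given_by_potential T f sigma.
Proof.
move=> N0 f0.
pose W (h : history R N) := weights f (positions h) ((size h)%:Z - T%:Z + 1).
have W0 h i : (size h < T)%N -> 0 <= W h 0 i.
  move=> hT; rewrite weightsE mulr_ge0 ?invr_ge0//.
  (* Time [t + 1] is [- m], where [m] counts the rounds left after the current one. *)
  have -> : (size h)%:Z - T%:Z + 1 = - (T - (size h).+1)%N%:Z.
    by lia.
  by apply: f0; lia.
(* The uniform vector also answers histories of length at least [T], where a probability vector is
   still required. *)
exists (fun h => if (size h < T)%N && (W h != 0)
  then (\sum_i W h 0 i)^-1 *: W h else const_mx N%:R^-1).
have S0 h : (size h < T)%N -> W h != 0 -> 0 < \sum_i W h 0 i.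
  move=> hT; rewrite lt_def sumr_ge0 => [|i _]; last exact: W0.
  rewrite andbT; apply: contra => /eqP /psumr_eq0P Wh0; apply/eqP/rowP => i.
  by rewrite Wh0 ?mxE// => j _; exact: W0.
split=> h.
- case: ifPn => [/andP[hT Wh]|_].
    have Sh := S0 h hT Wh.
    split => [i|]; first by rewrite mxE mulr_ge0 ?invr_ge0 ?W0// ltW.
    under eq_bigr do rewrite mxE.
    by rewrite -mulr_sumr mulVf// gt_eqF.
  split => [i|]; first by rewrite mxE invr_ge0.
  under eq_bigr do rewrite mxE.
  by rewrite -natr_mul_sum mulfV// pnatr_eq0 -lt0n.
- move=> hT w w0; rewrite hT/= w0; exists (\sum_i W h 0 i)^-1 => //.
  by rewrite invr_gt0 S0.
Qed.

(** [f] only supplies the weights, while [g m] estimates the loss with [m] rounds left; for moves in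
    [[-1, 1]] the two differ. Summed over the chips, the weight terms are nonnegative, so the mean
    of [g] grows by at most [err m] in a round. *)
Lemma potential_loss_le N T (G : drifting_game R) (f : R -> int -> R)
    (g : nat -> R -> R) (err : nat -> R) (e0 : R)
    (sigma : history R N -> 'rV[R]_N) tau : (0 < N)%N ->
  (forall m x z, (m < T)%N -> moves G z ->
    g m (x + z) + chip_weight f (- m%:Z) x * (z - drift G) <= g m.+1 x + err m) ->
  (forall x, loss G x <= g 0%N x + e0) ->
  player_strategy sigma -> given_by_potential T f sigma ->
  adversary_strategy G tau ->
  final_loss G T sigma tau <= g T 0 + \sum_(m < T) err m + e0.
Proof.
move=> N0 step final psigma fsigma ptau.
have Nne : N%:R != 0 :> R by rewrite pnatr_eq0 -lt0n.
pose x k i := positions (play sigma tau k) 0 i.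
suff main k : (k <= T)%N -> \sum_i g (T - k)%N (x k i) <=
    N%:R * (g T 0 + \sum_(T - k <= m < T) err m).
  have := main T (leqnn _); rewrite subnn big_mkord => hm.
  rewrite /final_loss mulrC ler_pdivrMr ?ltr0n//.
  apply: (@le_trans _ _ (\sum_i (g 0%N (x T i) + e0))).
    by apply: ler_sum => i _; exact: final.
  rewrite big_split/= -natr_mul_sum mulrC.
  by rewrite -[leRHS]mulrC [leRHS]mulrDr lerD// mulrC.
elim: k => [_|k ih kT].
  rewrite subn0 big_geq// addr0 (eq_bigr (fun=> g T 0)).
    by rewrite -natr_mul_sum.
  by move=> i _; rewrite /x /positions big_nil mxE.
have {ih} := ih (ltnW kT).
have -> : (T - k)%N = (T - k.+1).+1 by lia.
have mT : (T - k.+1 < T)%N by lia.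
have -> : (\sum_((T - k.+1).+1 <= m < T) err m =
    \sum_(T - k.+1 <= m < T) err m - err (T - k.+1)%N).
  by rewrite [in RHS]big_ltn// addrAC subrr add0r.
set m := (T - k.+1)%N in mT *.
set h := play sigma tau k; set p := sigma h; set z := tau h p.
have [p0 p1] : prob_vector p by exact: psigma.
have [zG pz] : admissible G p z by exact/ptau/psigma.
have xE i : x k.+1 i = x k i + z 0 i.
  by rewrite /x /= positions_rcons mxE.
(* If all weights vanish this holds whatever [p] is; otherwise the sum is a positive multiple of the
   slack in the adversary's constraint. *)
have w0 : 0 <= \sum_i chip_weight f (- m%:Z) (x k i) * (z 0 i - drift G).
  have := fsigma h; rewrite size_play => /(_ kT).
  have -> : k%:Z - T%:Z + 1 = - m%:Z by rewrite /m; lia.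
  set w := weights _ _ _; have wE i : w 0 i = N%:R^-1 * chip_weight f (- m%:Z) (x k i).
    exact: weightsE.
  have [w0 _|wn0 /(_ wn0)[c c0 pE]] := eqVneq w 0.
    rewrite big1// => i _; have /eqP := wE i; rewrite w0 mxE eq_sym mulf_eq0.
    by rewrite invr_eq0 (negbTE Nne)/= => /eqP->; rewrite mul0r.
  rewrite -(pmulr_rge0 _ (_ : 0 < c * N%:R^-1)).
  2: by rewrite mulr_gt0// invr_gt0 ltr0n.
  rewrite mulr_sumr (eq_bigr (fun i => p 0 i * z 0 i - p 0 i * drift G)).
    by rewrite sumrB -mulr_suml p1 mul1r subr_ge0.
  by move=> i _; rewrite /p pE mxE wE; ring.
have : \sum_i g m (x k.+1 i) + \sum_i chip_weight f (- m%:Z) (x k i) * (z 0 i - drift G)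
    <= \sum_i g m.+1 (x k i) + N%:R * err m.
  rewrite -big_split/= natr_mul_sum -big_split/=.
  by apply: ler_sum => i _; rewrite xE; exact: step.
by rewrite !mulrDr mulrN; lra.
Qed.

(** For each chip the drift is a mixture of two permitted moves that nearly preserves the potential.
    [round_all] makes the mixtures pure, keeping the constraint on [p]; the summed potential loses
    at most 1, as [g] takes values in [[0, 1]]. *)
Lemma greedy_round N (G : drifting_game R) (g g' : R -> R) (err : R)
    (s p : 'rV[R]_N) :
  (forall x, 0 <= g x <= 1) -> {homo g : x y /~ x <= y} ->
  (forall x, exists lo hi l : R, [/\ moves G lo /\ moves G hi, lo <= hi,
     0 <= l <= 1, drift G = l * hi + (1 - l) * lo &
     g' x - err <= l * g (x + hi) + (1 - l) * g (x + lo)]) ->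
  prob_vector p ->
  exists2 z : 'rV[R]_N, admissible G p z &
    \sum_i g' (s 0 i) - N%:R * err - 1 <= \sum_i g ((s + z) 0 i).
Proof.
move=> g01 gdecr split_drift [p0 p1].
have : forall i, exists u : R * R * R, [/\ moves G u.1.1 /\ moves G u.1.2,
     u.1.1 <= u.1.2, 0 <= u.2 <= 1, drift G = u.2 * u.1.2 + (1 - u.2) * u.1.1 &
     g' (s 0 i) - err <= u.2 * g (s 0 i + u.1.2) + (1 - u.2) * g (s 0 i + u.1.1)].
  by move=> i; have [lo [hi [l h]]] := split_drift (s 0 i); exists (lo, hi, l).
move=> /choice[u hu].
pose lo i := (u i).1.1; pose hi i := (u i).1.2; pose l i := (u i).2.
have [|||c [cP cB]] := @round_all R N (fun i => p 0 i * (hi i - lo i))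
  (fun i => g (s 0 i + hi i) - g (s 0 i + lo i)) l.
- by move=> i; have [_ ? _ _ _] := hu i; rewrite mulr_ge0// subr_ge0.
- move=> i; have [_ lohi _ _ _] := hu i.
  have := g01 (s 0 i + hi i); have := g01 (s 0 i + lo i).
  have : g (s 0 i + hi i) <= g (s 0 i + lo i) by apply: gdecr; rewrite lerD2l.
  by lra.
- by move=> i; have [] := hu i.
exists (\row_i (if c i then hi i else lo i)).
  split=> [i|]; first by rewrite mxE; have [[]] := hu i; case: ifP.
  rewrite -[drift G]mul1r -p1 mulr_suml.
  have -> : \sum_i p 0 i * drift G =
      \sum_i p 0 i * lo i + \sum_i p 0 i * (hi i - lo i) * l i.
    rewrite -big_split/=; apply: eq_bigr => i _.
    by have [_ _ _ -> _] := hu i; rewrite -/(lo i) -/(hi i) -/(l i); ring.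
  have -> : \sum_i p 0 i * (\row_i (if c i then hi i else lo i)) 0 i =
      \sum_i p 0 i * lo i + \sum_i p 0 i * (hi i - lo i) * (c i)%:R.
    rewrite -big_split/=; apply: eq_bigr => i _.
    by rewrite mxE; case: (c i) => /=; ring.
  by rewrite lerD2l.
have -> : \sum_i g ((s + \row_i (if c i then hi i else lo i)) 0 i) =
    \sum_i g (s 0 i + lo i) +
    \sum_i (g (s 0 i + hi i) - g (s 0 i + lo i)) * (c i)%:R.
  rewrite -big_split/=; apply: eq_bigr => i _.
  by rewrite !mxE; case: (c i) => /=; ring.
have : \sum_i g' (s 0 i) - N%:R * err <= \sum_i g (s 0 i + lo i) +
    \sum_i (g (s 0 i + hi i) - g (s 0 i + lo i)) * l i.
  rewrite natr_mul_sum -sumrB -big_split/=.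
  apply: ler_sum => i _; have [_ _ _ _] := hu i.
  by rewrite -/(lo i) -/(hi i) -/(l i); lra.
by lra.
Qed.

(** Iterates [greedy_round]; the unit lost in each round becomes [T / N] after averaging. *)
Lemma greedy_loss_ge N T (G : drifting_game R) (g : nat -> R -> R)
    (err : nat -> R) (e0 : R) (sigma : history R N -> 'rV[R]_N) : (0 < N)%N ->
  (forall m x, 0 <= g m x <= 1) -> (forall m, {homo g m : x y /~ x <= y}) ->
  (forall m x, exists lo hi l : R, [/\ moves G lo /\ moves G hi, lo <= hi,
     0 <= l <= 1, drift G = l * hi + (1 - l) * lo &
     g m.+1 x - err m <= l * g m (x + hi) + (1 - l) * g m (x + lo)]) ->
  (forall x, g 0%N x - e0 <= loss G x) ->
  player_strategy sigma ->
  exists2 tau, adversary_strategy G tau &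
    g T 0 - \sum_(m < T) err m - T%:R / N%:R - e0 <= final_loss G T sigma tau.
Proof.
move=> N0 g01 gdecr split_drift final psigma.
(* Truncated subtraction gives 0 on histories of length at least [T], where the adversary must still
   answer admissibly. *)
pose rem (h : history R N) := (T - (size h).+1)%N.
have /choice[tau ptau] : forall u : history R N * 'rV[R]_N, exists z : 'rV[R]_N,
    prob_vector u.2 -> admissible G u.2 z /\
    \sum_i g (rem u.1).+1 (positions u.1 0 i) - N%:R * err (rem u.1) - 1 <=
    \sum_i g (rem u.1) ((positions u.1 + z) 0 i).
  move=> [h p]; have [pp|np] := pselect (prob_vector p); last by exists 0.
  have [z zG zg] := @greedy_round N G _ _ _ (positions h) p
    (g01 (rem h)) (gdecr (rem h)) (split_drift (rem h)) pp.
  by exists z.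
pose tau' h p := tau (h, p).
exists tau' => [h p pp|]; first by have [] := ptau (h, p) pp.
pose x k i := positions (play sigma tau' k) 0 i.
suff main k : (k <= T)%N ->
    N%:R * (g T 0 - \sum_(T - k <= m < T) err m) - k%:R <= \sum_i g (T - k)%N (x k i).
  have := main T (leqnn _); rewrite subnn big_mkord => hm.
  rewrite /final_loss [leRHS]mulrC ler_pdivlMr ?ltr0n//.
  apply: (@le_trans _ _ (\sum_i (g 0%N (x T i) - e0))); last first.
    by apply: ler_sum => i _; exact: final.
  rewrite sumrB -natr_mul_sum mulrBl [e0 * _]mulrC lerD2r mulrC.
  apply: le_trans hm; rewrite mulrBr lerD2l lerN2 mulrC divfK//.
  by rewrite pnatr_eq0 -lt0n.
elim: k => [_|k ih kT].
  rewrite subn0 big_geq// !subr0 (eq_bigr (fun=> g T 0)).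
    by rewrite -natr_mul_sum.
  by move=> i _; rewrite /x /positions big_nil mxE.
have {ih} := ih (ltnW kT).
have -> : (T - k)%N = (T - k.+1).+1 by lia.
have mT : (T - k.+1 < T)%N by lia.
have -> : (\sum_((T - k.+1).+1 <= m < T) err m =
    \sum_(T - k.+1 <= m < T) err m - err (T - k.+1)%N).
  by rewrite [in RHS]big_ltn// addrAC subrr add0r.
have [_] := ptau (play sigma tau' k, sigma (play sigma tau' k)) (psigma _).
rewrite /= /rem size_play -natr1.
have -> : \sum_i g (T - k.+1)%N ((positions (play sigma tau' k) +
    tau (play sigma tau' k, sigma (play sigma tau' k))) 0 i) =
    \sum_i g (T - k.+1)%N (x k.+1 i).
  by apply: eq_bigr => i _; rewrite /x /= positions_rcons.
by rewrite !mulrBr => h1 h2; rewrite /x in h1 h2 *; lra.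
Qed.

End games.

(** * One-chip weights of smooth and clamped potentials *)

Section weights.
Context {R : realType}.
Implicit Types (x a b d : R).

(** The Caratheodory slope function is 0 to the left of [x] and continuous at [x]. *)
Lemma derive_cst_left (k : R -> R) x : (forall z, z < x -> k z = k x) ->
  derivable k x 1 -> 'D_1 k x = 0.
Proof.
move=> kx /derivableP/is_derive1_caratheodory[h [hE hc <-]].
have h1 : h z @[z --> x^'-] --> h x by apply: cvg_at_left_filter; exact: hc.
have h2 : h z @[z --> x^'-] --> (0 : R).
  apply: cvg_near_cst; near=> z.
  have zx : z < x by near: z; exact: nbhs_left_lt.
  have := hE z; rewrite (kx _ zx) subrr => /esym/eqP.
  by rewrite mulf_eq0 subr_eq0 (lt_eqF zx) orbF => /eqP.
exact: (cvg_unique _ h1 h2).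
Unshelve. all: by end_near. Qed.

Lemma chip_weight_derive (f : R -> int -> R) t x d :
  is_derive x 1 (f^~ t) d -> chip_weight f t x = - d.
Proof.
move=> df; rewrite /chip_weight asboolT; last exact: ex_derive.
by rewrite (@derive_val _ _ _ _ _ _ _ df).
Qed.

(** Settles the kink of a clamped potential without deciding differentiability: the convention and
    the derivative both give 0. *)
Lemma chip_weight_cst_left (f : R -> int -> R) t x :
  (forall z, z < x -> f z t = f x t) -> chip_weight f t x = 0.
Proof.
move=> fx; rewrite /chip_weight; case: asboolP => // df.
by rewrite (@derive_cst_left (f^~ t)) ?oppr0.
Qed.

Lemma is_derive_heat_addr x b a :
  is_derive x 1 (fun x => heat (x + b) a) (- slope (x + b) a).
Proof.
have ds : is_derive x 1 (id + cst b) (1 : R).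
  by apply: is_derive_eq; rewrite addr0.
have h := @is_derive1_comp _ (heat^~ a) _ x _ _ (is_derive_heat (x + b) a) ds.
by apply: (is_derive_eq h); rewrite mulr1.
Qed.

Lemma is_derive_heat_max x b d a : d < x + b ->
  is_derive x 1 (fun x => 2 * heat (Num.max (x + b) d) a) (- (2 * slope (x + b) a)).
Proof.
move=> dx.
apply: (@near_eq_is_derive _ _ _ (2 \*: (fun x => heat (x + b) a))).
  near=> z => /=; congr (2 * heat _ a); apply/esym/max_idPl/ltW.
  rewrite -ltrBlDr; near: z; apply: lt_nbhsr; lra.
have dh := is_derive_heat_addr x b a.
by apply: is_derive_eq; rewrite /GRing.scale/= mulrN.
Unshelve. all: by end_near. Qed.

End weights.

(** * Strategies for the four versions *)

Section strategies.
Context {R : realType}.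
Implicit Types (x a b d : R).

(** The moves [1] and [-1] with these weights average to [d], so the slope terms of [heat_step]
    cancel; of the curvature only a [d ^+ 2] term remains. *)
Lemma heat_average_ge x d a : 1 <= a -> 0 <= d <= 1 ->
  heat (x + d) (a + 1) - (44 / Num.sqrt a ^+ 3 + d ^+ 2 / a / 2) <=
  (1 + d) / 2 * heat (x + 1) a + (1 - (1 + d) / 2) * heat (x - 1) a.
Proof.
move=> a1 /andP[d0 d1].
have dd : `|d| <= 1 by rewrite ger0_norm.
have z1 : `|1 : R| <= 1 by rewrite normr1.
have zN1 : `|-1 : R| <= 1 by rewrite normrN1.
have := heat_step x _ _ _ a1 z1 dd; have := heat_step x _ _ _ a1 zN1 dd.
have := norm_curv_le x _ a1.
move: (heat (x + 1) a) (heat (x - 1) a) (heat (x + d) (a + 1)) (slope x a) (curv x a).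
move=> h1 hN1 h s c; set K := 44 / _; rewrite !ler_norml sqrrN expr1n subrr sub0r.
move=> /andP[_ ca] /andP[hN _] /andP[hP _].
have l0 : 0 <= (1 + d) / 2 by lra.
have l1 : 0 <= 1 - (1 + d) / 2 by lra.
have := ler_wpM2l l0 hP; have := ler_wpM2l l1 hN.
have := ler_wpM2l (sqr_ge0 d) ca.
by lra.
Qed.

Lemma sum_step_error A B t T : 0 <= A -> 1 <= t ->
  \sum_(m < T) (A / Num.sqrt (m%:R + t) ^+ 3 + B) <=
    6 * A / Num.sqrt t + T%:R * B :> R.
Proof.
move=> A0 t1; rewrite big_split/= -mulr_sumr -natr_mul_sum lerD2r.
by apply: le_trans (ler_wpM2l A0 (sum_inv_sqrt3 _ _ t1)) _; rewrite mulrCA mulrA.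
Qed.

Lemma heat0_ge x a : x <= 0 -> 1 / 2 <= heat x a.
Proof.
move=> x0; rewrite -Psi0; apply: Psi_decr.
by rewrite mulr_le0_ge0// invr_ge0 sqrtr_ge0.
Qed.

Lemma heat0_le x a : 0 <= x -> heat x a <= 1 / 2.
Proof.
move=> x0; rewrite -Psi0; apply: Psi_decr.
by rewrite mulr_ge0// invr_ge0 sqrtr_ge0.
Qed.

Lemma min_heat_pos x a : 0 <= x -> Num.min 1 (2 * heat x a) = 2 * heat x a.
Proof. by move=> x0; apply/min_idPr; rewrite -ler_pdivlMl// mulrC heat0_le. Qed.

Lemma min_heat_neg x a : x <= 0 -> Num.min 1 (2 * heat x a) = 1.
Proof. by move=> x0; apply/min_idPl; rewrite -ler_pdivrMl// mulrC heat0_ge. Qed.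

(** At clock [q ^+ 2] a shift by [q ^+ 2] is [q] standard deviations, so smoothing the terminal
    condition costs only [1 / q]. *)
Lemma heat_terminal_le q x : 1 <= q -> q ^+ 2 <= x -> heat x (q ^+ 2) <= q^-1.
Proof.
move=> q1 qx; apply: le_trans (Psi_le_inv q _); last by lra.
apply: Psi_decr; rewrite sqrtr_sqr ger0_norm; last by lra.
by rewrite ler_pdivlMr -?expr2//; lra.
Qed.

Lemma heat_terminal_ge q x : 1 <= q -> x <= - q ^+ 2 -> 1 - q^-1 <= heat x (q ^+ 2).
Proof.
move=> q1 qx.
have -> : heat x (q ^+ 2) = 1 - heat (- x) (q ^+ 2).
  by rewrite /heat mulNr PsiN; ring.
by rewrite lerD2l lerN2 heat_terminal_le// lerNr.
Qed.

(* A chip at [s] with [m] rounds to go sits at [s + rho + d * m] in the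
   coordinate in which the losing half-line is [x <= 0] and an average move
   leaves [x] unchanged; [x0] is its starting point in units of [sqrt T]. *)
Record normalized (G : drifting_game R) (T : nat) (rho d q x0 : R) : Prop :=
  Normalized {
    norm_q1 : 1 <= q;
    norm_qT : T%:R = q ^+ 6;
    norm_d01 : 0 <= d <= 1;
    norm_x0 : 0 <= x0;
    norm_start : rho + d * T%:R = x0 * Num.sqrt T%:R;
    norm_dT : d ^+ 2 * T%:R <= x0 ^+ 2;
    norm_drift : drift G = d;
    norm_loss : forall s, loss G s = ((s <= - rho)%R)%:R }.

Arguments norm_q1 {G T rho d q x0}.
Arguments norm_qT {G T rho d q x0}.
Arguments norm_d01 {G T rho d q x0}.
Arguments norm_x0 {G T rho d q x0}.
Arguments norm_start {G T rho d q x0}.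
Arguments norm_dT {G T rho d q x0}.
Arguments norm_drift {G T rho d q x0}.
Arguments norm_loss {G T rho d q x0}.

(** The shift [c] puts the final potential on the required side of the loss up to [O(1 / q)]:
    [- q ^+ 2] for moves of size 1 in the upper bound, [q ^+ 2] in the lower bounds, 0 for the
    truncated upper bound. *)
Definition rem_pos (rho d c : R) (m : nat) (s : R) : R := s + (rho + d * m%:R + c).

Lemma rem_posS rho d c m s : rem_pos rho d c m.+1 s = rem_pos rho d c m s + d.
Proof. by rewrite /rem_pos -[m.+1%:R]natr1; ring. Qed.

Lemma rem_posD rho d c m s z : rem_pos rho d c m (s + z) = rem_pos rho d c m s + z.
Proof. by rewrite /rem_pos addrAC. Qed.

#[local] Opaque Psi heat slope curv.

Lemma sqrt_rounds {G : drifting_game R} {T : nat} {rho d q x0 : R}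
    (nG : normalized G T rho d q x0) : Num.sqrt T%:R = q ^+ 3.
Proof.
have q1 := norm_q1 nG; have q0 := lt_le_trans ltr01 q1.
by rewrite (norm_qT nG) (exprM q 3 2) sqrtr_sqr ger0_norm// exprn_ge0// ltW.
Qed.

Lemma drift_error_le {d} m t : 1 <= t -> d ^+ 2 / (m%:R + t) / 2 <= d ^+ 2 / t / 2.
Proof.
move=> t1; rewrite ler_pM2r ?invr_gt0// ler_wpM2l ?sqr_ge0//.
by rewrite lef_pV2 ?posrE ?lerDr//; have := ler0n R m; lra.
Qed.

Lemma rem_pos_step {G : drifting_game R} {T : nat} {rho d q x0 : R}
    (nG : normalized G T rho d q x0) m c t s z : 1 <= t -> `|z| <= 1 ->
  heat (rem_pos rho d c m (s + z)) (m%:R + t) +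
    slope (rem_pos rho d c m s) (m%:R + t) * (z - d) <=
  heat (rem_pos rho d c m.+1 s) (m.+1%:R + t) +
    (z ^+ 2 - 1 - d ^+ 2) / 2 * curv (rem_pos rho d c m s) (m%:R + t) +
    44 / Num.sqrt (m%:R + t) ^+ 3.
Proof.
have d01 := norm_d01 nG.
move=> t1 z1; set x := rem_pos rho d c m s; set a := m%:R + t.
have a1 : 1 <= a by rewrite ler_wpDl.
have dd : `|d| <= 1 by have /andP[? ?] := d01; rewrite ger0_norm.
have -> : m.+1%:R + t = a + 1 by rewrite -[m.+1%:R]natr1 /a; ring.
rewrite rem_posS rem_posD -/x.
have := heat_step x _ _ _ a1 z1 dd; rewrite ler_norml => /andP[_].
move: (heat (x + z) a) (slope x a) (heat (x + d) (a + 1)) (curv x a) => h s' h' c'.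
by clear; move: (Num.sqrt a) => r; lra.
Qed.

Lemma rem_pos_start {G : drifting_game R} {T : nat} {rho d q x0 : R}
    (nG : normalized G T rho d q x0) c t : 0 <= t ->
  `|heat (rem_pos rho d c T 0) (T%:R + t) - Psi x0| <= `|c| / q ^+ 3 + x0 * (t / q ^+ 6).
Proof.
have q1 := norm_q1 nG; have q0 := lt_le_trans ltr01 q1.
have x00 := norm_x0 nG.
move=> t0; rewrite /rem_pos add0r (norm_start nG) -(sqrt_rounds nG) -(norm_qT nG).
by apply: heat_start => //; rewrite (norm_qT nG) exprn_ege1.
Qed.

Lemma inv_expr_le {G : drifting_game R} {T : nat} {rho d q x0 : R}
    (nG : normalized G T rho d q x0) n : (q ^+ n.+1)^-1 <= q^-1.
Proof.
have q1 := norm_q1 nG; have q0 := lt_le_trans ltr01 q1.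
by rewrite lef_pV2 ?posrE ?exprn_gt0// -[leLHS]expr1 ler_weXn2l.
Qed.

(** [d ^+ 2 * T] stays below [x0 ^+ 2], so the clock bound [q ^+ 2] makes the total [O(q ^- 2)];
    only [1 / q] is kept. *)
Lemma drift_error_sum {G : drifting_game R} {T : nat} {rho d q x0 : R}
    (nG : normalized G T rho d q x0) : T%:R * (d ^+ 2 / q ^+ 2 / 2) <= x0 ^+ 2 / q.
Proof.
have q1 := norm_q1 nG; have q0 := lt_le_trans ltr01 q1.
have -> : T%:R * (d ^+ 2 / q ^+ 2 / 2) = d ^+ 2 * T%:R * (q ^+ 2)^-1 / 2 by ring.
have h : d ^+ 2 * T%:R * (q ^+ 2)^-1 <= x0 ^+ 2 / q.
  apply: (ler_pM _ _ (norm_dT nG) (inv_expr_le nG 1)); first by rewrite mulr_ge0 ?sqr_ge0.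
  by rewrite invr_ge0 sqr_ge0.
have : 0 <= x0 ^+ 2 / q by rewrite divr_ge0 ?sqr_ge0// ltW.
lra.
Qed.

Lemma start_error_sum {G : drifting_game R} {T : nat} {rho d q x0 : R}
    (nG : normalized G T rho d q x0) : x0 * (q ^+ 2 / q ^+ 6) <= x0 / q.
Proof.
have q1 := norm_q1 nG; have q0 := lt_le_trans ltr01 q1.
have x00 := norm_x0 nG.
have -> : q ^+ 2 / q ^+ 6 = (q ^+ 4)^-1 by field; rewrite gt_eqF.
by rewrite ler_wpM2l// (inv_expr_le nG).
Qed.

Lemma sum_errors {G : drifting_game R} {T : nat} {rho d q x0 : R}
    (nG : normalized G T rho d q x0) A B : 0 <= A -> 0 <= B ->
  \sum_(m < T) (A / Num.sqrt (m%:R + q ^+ 2) ^+ 3 + B * (d ^+ 2 / q ^+ 2 / 2)) <=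
    (6 * A + B * x0 ^+ 2) / q.
Proof.
have q1 := norm_q1 nG; have q0 := lt_le_trans ltr01 q1.
move=> A0 B0; have t1 : 1 <= q ^+ 2 by rewrite exprn_ege1.
apply: le_trans (sum_step_error _ _ _ T A0 t1) _.
rewrite sqrtr_sqr (gtr0_norm q0) [leRHS]mulrDl lerD2l mulrCA -[leRHS]mulrA.
by apply: ler_wpM2l => //; exact: (drift_error_sum nG).
Qed.

Lemma start_errors {G : drifting_game R} {T : nat} {rho d q x0 : R}
    (nG : normalized G T rho d q x0) c : `|c| = q ^+ 2 ->
  `|heat (rem_pos rho d c T 0) (T%:R + q ^+ 2) - Psi x0| <= (1 + x0) / q.
Proof.
have q1 := norm_q1 nG; have q0 := lt_le_trans ltr01 q1.
move=> cE; apply: le_trans (rem_pos_start nG _ _ (sqr_ge0 q)) _.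
have -> : `|c| / q ^+ 3 = q^-1 by rewrite cE; field; rewrite gt_eqF.
by rewrite mulrDl mul1r lerD2l (start_error_sum nG).
Qed.

(** When [z ^+ 2 = 1] the second-order term is a pure drift error. The constant collects [6 * 44]
    from the steps, 1 from the end, [1 + x0] from the start and [x0 ^+ 2] from the drift. *)
Lemma sign_upper_bound {G : drifting_game R} {T : nat} {rho d q x0 : R}
    (nG : normalized G T rho d q x0) N :
  (0 < N)%N -> (forall z, moves G z -> z ^+ 2 = 1) ->
  exists f : R -> int -> R, [/\ potential T f,
      exists sigma : history R N -> 'rV[R]_N,
        player_strategy sigma /\ given_by_potential T f sigma &
      forall sigma : history R N -> 'rV[R]_N,
        player_strategy sigma -> given_by_potential T f sigma ->
      forall tau, adversary_strategy G tau ->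
        final_loss G T sigma tau <= Psi x0 + (266 + x0 ^+ 2 + x0) / q].
Proof.
have q1 := norm_q1 nG; have q0 := lt_le_trans ltr01 q1.
move=> N0 moves1; pose t := q ^+ 2.
have t1 : 1 <= t by rewrite exprn_ege1.
pose g m s := heat (rem_pos rho d (- t) m s) (m%:R + t).
pose f s (i : int) := g `|i|%N s.
have fw m s : chip_weight f (- m%:Z) s = slope (rem_pos rho d (- t) m s) (m%:R + t).
  have dh : is_derive s 1 (f^~ (- m%:Z)) (- slope (rem_pos rho d (- t) m s) (m%:R + t)).
    by rewrite /f abszN absz_nat; exact: is_derive_heat_addr.
  by rewrite (chip_weight_derive _ _ _ _ dh) opprK.
exists f; split.
- move=> i _ y x xy; apply: heat_decr; first by rewrite lerD2r.
- by apply: exists_potential_strategy => // m s _; rewrite fw slope_ge0.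
move=> sigma psigma fsigma tau ptau.
have := @potential_loss_le R N T G f g
  (fun m => 44 / Num.sqrt (m%:R + t) ^+ 3 + 1 * (d ^+ 2 / t / 2)) q^-1 sigma tau N0.
move=> /(_ _ _ psigma fsigma ptau) h; apply: le_trans (h _ _) _.
- move=> m s z mT /moves1 z2; rewrite fw (norm_drift nG).
  have z1 : `|z| <= 1 by rewrite -(@expr_le1 _ 2)// real_normK ?num_real// z2.
  apply: (le_trans (rem_pos_step nG _ _ _ _ _ t1 z1)).
  rewrite -/(g m.+1 s) z2 subrr sub0r.
  rewrite -addrA lerD2l addrC lerD2l mul1r; apply: le_trans (@drift_error_le d m _ t1).
  have a1 : 1 <= m%:R + t by rewrite ler_wpDl.
  have := norm_curv_le (rem_pos rho d (- t) m s) _ a1.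
  rewrite ler_norml => /andP[+ _] => /(ler_wpM2l (sqr_ge0 d)).
  by move: (m%:R + t) (curv _ _); clear => a c; lra.
- move=> s; rewrite (norm_loss nG) /g /rem_pos mulr0 addr0 add0r.
  case: (leP s (- rho)) => /= [sr|_]; last by rewrite addr_ge0 ?heat_ge0// invr_ge0 ltW.
  rewrite -lerBlDr heat_terminal_ge//; move: sr; rewrite /t; clear; lra.
have := sum_errors nG 44 1 (ler0n R 44) ler01.
have := start_errors nG (- t).
rewrite normrN -/(g T 0) ger0_norm ?sqr_ge0// => /(_ erefl).
rewrite ler_norml -/t => /andP[_]; move: (g T 0) (\sum_(m < T) _) (Psi x0).
by clear => G0 S P; lra.
Qed.

Lemma interval_upper_bound {G : drifting_game R} {T : nat} {rho d q x0 : R}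
    (nG : normalized G T rho d q x0) N :
  (0 < N)%N -> (forall z, moves G z -> `|z| <= 1) ->
  exists f : R -> int -> R, [/\ potential T f,
      exists sigma : history R N -> 'rV[R]_N,
        player_strategy sigma /\ given_by_potential T f sigma &
      forall sigma : history R N -> 'rV[R]_N,
        player_strategy sigma -> given_by_potential T f sigma ->
      forall tau, adversary_strategy G tau ->
        final_loss G T sigma tau <= 2 * Psi x0 + (540 + 2 * x0) / q ^+ 2].
Proof.
have q1 := norm_q1 nG; have q0 := lt_le_trans ltr01 q1.
have d01 := norm_d01 nG.
(* Without shift there is no terminal error, so more smoothing is affordable: the step errors, of
   order [t^(-1/2)], and the start error, of order [t / T], balance at [q ^- 2]. *)
move=> N0 moves1; pose t := q ^+ 4.
have t1 : 1 <= t by rewrite exprn_ege1.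
have [d0 d1] := andP d01.
pose g m s := Num.min 1 (2 * heat (rem_pos rho d 0 m s) (m%:R + t)).
pose f s (i : int) :=
  2 * heat (Num.max (rem_pos rho d 0 `|i|%N s) (- d)) (`|i|%N%:R + t).
have fw0 m s : rem_pos rho d 0 m s <= - d -> chip_weight f (- m%:Z) s = 0.
  move=> sd; apply: chip_weight_cst_left => z zs.
  rewrite /f abszN absz_nat (max_idPr sd) (max_idPr (le_trans _ sd))//.
  by rewrite lerD2r ltW.
have fw m s : - d < rem_pos rho d 0 m s ->
    chip_weight f (- m%:Z) s = 2 * slope (rem_pos rho d 0 m s) (m%:R + t).
  move=> sd; have dh : is_derive s 1 (f^~ (- m%:Z))
      (- (2 * slope (rem_pos rho d 0 m s) (m%:R + t))).
    by rewrite /f abszN absz_nat; exact: is_derive_heat_max.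
  by rewrite (chip_weight_derive _ _ _ _ dh) opprK.
exists f; split.
- move=> i _ y x xy; rewrite ler_pM2l//; apply: heat_decr.
  by rewrite ge_max !le_max lerD2r xy lexx orbT.
- apply: exists_potential_strategy => // m s _.
  have [/fw0->//|/fw->] := leP (rem_pos rho d 0 m s) (- d).
  by rewrite mulr_ge0// slope_ge0.
move=> sigma psigma fsigma tau ptau.
have := @potential_loss_le R N T G f g
  (fun m => 90 / Num.sqrt (m%:R + t) ^+ 3 + 0) 0 sigma tau N0.
move=> /(_ _ _ psigma fsigma ptau) h; apply: le_trans (h _ _) _.
- move=> m s z mT /moves1 z1; rewrite (norm_drift nG) addr0.
  have a1 : 1 <= m%:R + t by rewrite ler_wpDl.
  have r0 : 0 < Num.sqrt (m%:R + t) ^+ 3.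
    by rewrite exprn_gt0// (lt_le_trans ltr01)// sqrt_ge1.
  have r0' : 0 <= 90 / Num.sqrt (m%:R + t) ^+ 3 by rewrite divr_ge0// ltW.
  have [sd|sd] := leP (rem_pos rho d 0 m s) (- d).
    rewrite (fw0 m s sd) mul0r (addr0 (g m (s + z))).
    apply: (@le_trans _ _ 1); first by rewrite ge_min lexx.
    have -> : g m.+1 s = 1; last by rewrite lerDl.
    by apply: min_heat_neg; rewrite rem_posS -lerBrDr sub0r.
  have gS : g m.+1 s = 2 * heat (rem_pos rho d 0 m.+1 s) (m.+1%:R + t).
    by apply: min_heat_pos; rewrite rem_posS -lerBlDr sub0r ltW.
  rewrite (fw _ _ sd) gS.
  have le_g : g m (s + z) <= 2 * heat (rem_pos rho d 0 m (s + z)) (m%:R + t).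
    by rewrite ge_min lexx orbT.
  have := (rem_pos_step nG) m 0 _ s _ t1 z1.
  (* Convexity gives a nonnegative value for [x >= 0]; in the strip [- d < x < 0] one has
     [|x| <= 1]. With a coefficient at most 2 this raises [2 * 44] to 90. *)
  have curv_ge : - (Num.sqrt (m%:R + t) ^+ 3)^-1 <=
      curv (rem_pos rho d 0 m s) (m%:R + t).
    have [s0|s0] := leP 0 (rem_pos rho d 0 m s).
      apply: (@le_trans _ _ 0); first by rewrite oppr_le0 invr_ge0 ltW.
      by apply: curv_ge0 => //; apply: le_trans a1.
    have := norm_curv_le_abs (rem_pos rho d 0 m s) _ a1.
    rewrite ler_norml => /andP[+ _]; apply: le_trans; rewrite lerN2.
    rewrite -[leRHS]mul1r ler_wpM2r ?invr_ge0 ?(ltW r0)// ltr0_norm// lerNl.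
    by apply: le_trans (ltW sd); rewrite lerN2.
  have z2 : 0 <= z ^+ 2 <= 1.
    by rewrite sqr_ge0 -real_normK ?num_real// expr_le1.
  have d2 : 0 <= d ^+ 2 <= 1 by rewrite sqr_ge0 expr_le1.
  have coef : 0 <= 1 + d ^+ 2 - z ^+ 2 <= 2 by move: z2 d2; clear; lra.
  have [coef0 coef2] := andP coef.
  have := ler_wpM2l coef0 curv_ge.
  have : (1 + d ^+ 2 - z ^+ 2) * (Num.sqrt (m%:R + t) ^+ 3)^-1 <=
      2 * (Num.sqrt (m%:R + t) ^+ 3)^-1.
    by rewrite ler_wpM2r ?invr_ge0 ?(ltW r0).
  move: le_g; rewrite mulrN; move: (g m (s + z)) (curv _ _) (slope _ _) (_ ^-1).
  move: (heat _ _) (heat (rem_pos rho d 0 m (s + z)) _).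
  by clear => a1 a2 a3 a4 a5 a6; lra.
- move=> s; rewrite (norm_loss nG) /g /rem_pos mulr0 !addr0.
  case: (leP s (- rho)) => /= [sr|_]; last first.
    by rewrite le_min ler01 mulr_ge0// heat_ge0.
  by rewrite min_heat_neg// -lerBrDr sub0r.
have := @sum_step_error 90 0 t T (ler0n R 90) t1; rewrite mulr0 addr0.
have -> : Num.sqrt t = q ^+ 2.
  by rewrite /t (exprM q 2 2) sqrtr_sqr ger0_norm// sqr_ge0.
move=> sum_le.
have := rem_pos_start nG 0 t (le_trans ler01 t1); rewrite normr0 mul0r add0r ler_norml.
have -> : t / q ^+ 6 = (q ^+ 2)^-1 by rewrite /t; field; rewrite gt_eqF.
move=> /andP[_ start].
have : g T 0 <= 2 * heat (rem_pos rho d 0 T 0) (T%:R + t).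
  by rewrite ge_min lexx orbT.
move: sum_le start; rewrite addr0.
move: (g T 0) (\sum_(m < T) _) (Psi x0) (heat _ _) (_ ^-1).
by clear => a1 a2 a3 a4 a5; lra.
Qed.

(** This fixes the threshold [T ^ 2] on the number of chips: the roundings cost at most [1 / T] in
    all. *)
Lemma rounding_error_sum {G : drifting_game R} {T : nat} {rho d q x0 : R}
    (nG : normalized G T rho d q x0) N : (T ^ 2 <= N)%N -> T%:R / N%:R <= q^-1.
Proof.
have q1 := norm_q1 nG; have q0 := lt_le_trans ltr01 q1.
move=> TN; have T0 : 0 < T%:R :> R by rewrite (norm_qT nG) exprn_gt0.
have N0 : 0 < N%:R :> R.
  by rewrite ltr0n (leq_trans _ TN)// expn_gt0 -(ltr0n R) T0.
apply: (@le_trans _ _ T%:R^-1); last by rewrite (norm_qT nG) (inv_expr_le nG).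
rewrite ler_pdivrMr// -ler_pdivrMl ?invr_gt0// invrK -expr2 -natrX ler_nat.
exact: TN.
Qed.

(** Splitting the drift between [-1] and [1] nearly preserves the heat potential; the positive shift
    makes surviving chips contribute at most [1 / q] at the end. *)
Lemma sign_lower_bound {G : drifting_game R} {T : nat} {rho d q x0 : R}
    (nG : normalized G T rho d q x0) N : (T ^ 2 <= N)%N -> (0 < N)%N ->
  moves G 1 -> moves G (- 1) ->
  forall sigma : history R N -> 'rV[R]_N, player_strategy sigma ->
  exists2 tau, adversary_strategy G tau &
    Psi x0 - (267 + x0 ^+ 2 + x0) / q <= final_loss G T sigma tau.
Proof.
have q1 := norm_q1 nG; have q0 := lt_le_trans ltr01 q1.
have d01 := norm_d01 nG.
move=> TN N0 m1 mN1 sigma psigma; pose t := q ^+ 2.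
have t1 : 1 <= t by rewrite exprn_ege1.
have [d0 d1] := andP d01.
pose g m s := heat (rem_pos rho d t m s) (m%:R + t).
have [||||tau ptau le_loss] := @greedy_loss_ge R N T G g
  (fun m => 44 / Num.sqrt (m%:R + t) ^+ 3 + 1 * (d ^+ 2 / t / 2))
  q^-1 sigma N0 _ _ _ _ psigma.
- by move=> m s; rewrite heat_ge0 heat_le1.
- by move=> m y x xy; apply: heat_decr; rewrite lerD2r.
- move=> m s; exists (- 1), 1, ((1 + d) / 2); rewrite (norm_drift nG).
  split; [by []|by move: d01; clear; lra|by move: d01; clear; lra|by field|].
  have a1 : 1 <= m%:R + t by rewrite ler_wpDl.
  have := heat_average_ge (rem_pos rho d t m s) _ _ a1 d01.
  rewrite /g !rem_posD rem_posS.
  have -> : m.+1%:R + t = m%:R + t + 1 by rewrite -[m.+1%:R]natr1; ring.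
  move: (@drift_error_le d m _ t1).
  move: (d ^+ 2 / _ / 2) (d ^+ 2 / t / 2) (_ ^- 3) (heat _ _) (heat _ _) (heat _ _).
  by clear => a1 a2 a3 a4 a5 a6; lra.
- move=> s; rewrite (norm_loss nG) /g /rem_pos mulr0 addr0 add0r.
  case: (leP s (- rho)) => /= sr.
    by rewrite lerBlDr (le_trans (heat_le1 _ _))// lerDl invr_ge0 ltW.
  by rewrite subr_le0 heat_terminal_le//; move: sr; rewrite /t; clear; lra.
exists tau => //; apply: le_trans le_loss.
have := sum_errors nG 44 1 (ler0n R 44) ler01.
have := start_errors nG t; rewrite -/(g T 0) ger0_norm ?sqr_ge0// => /(_ erefl).
rewrite ler_norml -/t => /andP[+ _]; have := rounding_error_sum nG N TN.
move: (g T 0) (\sum_(m < T) _) (Psi x0) (_ / _%:R).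
by clear => a1 a2 a3 a4; lra.
Qed.

(* Chips with [x <= 3] are parked, that is moved by [d] exactly; the margin keeps
   the others in [x >= 0], where [min (1, 2 v) = 2 v], after a move [-1]. *)
Lemma interval_lower_bound {G : drifting_game R} {T : nat} {rho d q x0 : R}
    (nG : normalized G T rho d q x0) N : (T ^ 2 <= N)%N -> (0 < N)%N ->
  (forall z, -1 <= z <= 1 -> moves G z) ->
  forall sigma : history R N -> 'rV[R]_N, player_strategy sigma ->
  exists2 tau, adversary_strategy G tau &
    2 * Psi x0 - (533 + 2 * x0 ^+ 2 + 2 * x0) / q <= final_loss G T sigma tau.
Proof.
have q1 := norm_q1 nG; have q0 := lt_le_trans ltr01 q1.
have d01 := norm_d01 nG.
have x00 := norm_x0 nG.
move=> TN N0 mG sigma psigma; pose t := q ^+ 2.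
have t1 : 1 <= t by rewrite exprn_ege1.
have [d0 d1] := andP d01.
pose g m s := Num.min 1 (2 * heat (rem_pos rho d t m s) (m%:R + t)).
have [||||tau ptau le_loss] := @greedy_loss_ge R N T G g
  (fun m => 88 / Num.sqrt (m%:R + t) ^+ 3 + 2 * (d ^+ 2 / t / 2))
  (2 / q) sigma N0 _ _ _ _ psigma.
- by move=> m s; rewrite le_min ler01 mulr_ge0 ?heat_ge0//= ge_min lexx.
- move=> m y x xy; rewrite le_min ge_min lexx/= ge_min; apply/orP; right.
  by rewrite ler_pM2l//; apply: heat_decr; rewrite lerD2r.
- move=> m s; rewrite (norm_drift nG).
  have a1 : 1 <= m%:R + t by rewrite ler_wpDl.
  have mS : m.+1%:R + t = m%:R + t + 1 by rewrite -[m.+1%:R]natr1; ring.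
  have r0 : 0 <= (Num.sqrt (m%:R + t) ^+ 3)^-1.
    by rewrite invr_ge0 exprn_ge0// sqrtr_ge0.
  have dt : 0 <= d ^+ 2 / t / 2 by rewrite !divr_ge0 ?sqr_ge0.
  have [x3|x3] := leP (rem_pos rho d t m.+1 s) 3.
    (* For a parked chip both moves are [d]: the coordinate stays and only the clock changes. *)
    exists d, d, 0; split; [|by []|by rewrite lexx ler01|by rewrite mul0r subr0 add0r mul1r|].
      by split; apply: mG; move: d01; clear; lra.
    rewrite mul0r subr0 add0r mul1r /g rem_posD -rem_posS mS.
    move: (rem_pos rho d t m.+1 s) x3 => x x3; move: (m%:R + t) a1 r0 => a a1 r0.
    rewrite lerBlDr; have [xn|xp] := leP x 0.
      rewrite (min_heat_neg x a xn) ge_min; apply/orP; left.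
      by rewrite lerDl addr_ge0// mulr_ge0.
    rewrite (min_heat_pos x a (ltW xp)) ge_min; apply/orP; right.
    (* Since [x <= 3], the clock step costs [2 v] at most [2 * (34 + 3 / 2)] times [a^(-3/2)],
       within the allowed 88. *)
    have := heat_time x _ a1; have := norm_curv_le_abs x _ a1.
    have : `|x| / Num.sqrt a ^+ 3 <= 3 / Num.sqrt a ^+ 3.
      by rewrite ler_wpM2r// gtr0_norm.
    rewrite !ler_norml; move: dt r0.
    move: (d ^+ 2 / t / 2) (_ ^- 3) (heat _ _) (heat _ _) (curv _ _).
    by clear => a1 a2 a3 a4 a5; lra.
  exists (- 1), 1, ((1 + d) / 2).
  split; [|by move: d01; clear; lra|by move: d01; clear; lra|by field|].
    by split; apply: mG; clear; lra.
  have := heat_average_ge (rem_pos rho d t m s) _ _ a1 d01.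
  rewrite rem_posS in x3.
  rewrite /g !rem_posD rem_posS mS.
  move: (rem_pos rho d t m s) x3 => x x3.
  have [p1 pN1 pd] : [/\ 0 <= x + 1, 0 <= x - 1 & 0 <= x + d].
    by split; move: x3 d01; clear; lra.
  rewrite (min_heat_pos _ _ p1) (min_heat_pos _ _ pN1) (min_heat_pos _ _ pd).
  move: (@drift_error_le d m _ t1).
  move: (d ^+ 2 / _ / 2) (d ^+ 2 / t / 2) (_ ^- 3) (heat _ _) (heat _ _) (heat _ _).
  by clear => a1 a2 a3 a4 a5 a6; lra.
- move=> s; rewrite (norm_loss nG) /g /rem_pos mulr0 addr0 add0r.
  have q20 : 0 <= 2 / q by rewrite divr_ge0// ltW.
  case: (leP s (- rho)) => /= sr; rewrite lerBlDr ge_min.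
    by rewrite lerDl q20.
  apply/orP; right; rewrite add0r ler_pM2l// heat_terminal_le//.
  by move: sr; rewrite /t; clear; lra.
exists tau => //; apply: le_trans le_loss.
have -> : g T 0 = 2 * heat (rem_pos rho d t T 0) (T%:R + t).
  apply: min_heat_pos; rewrite /rem_pos add0r (norm_start nG).
  by rewrite addr_ge0 ?(le_trans ler01 t1)// mulr_ge0// sqrtr_ge0.
have := sum_errors nG 88 2 (ler0n R 88) (ler0n R 2).
have := start_errors nG t; rewrite ger0_norm ?sqr_ge0// => /(_ erefl).
rewrite ler_norml -/t => /andP[+ _]; have := rounding_error_sum nG N TN.
move: (heat _ _) (\sum_(m < T) _) (Psi x0) (_ / _%:R).
by clear => a1 a2 a3 a4; lra.
Qed.


End strategies.

(** * Parameters of the four versions and rates *)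

Section calibration.
Context {R : realType}.

(** V1 and V2 take [rho = 0] and [d = a], V3 and V4 take [rho = a] and [d = 0]; either way the start
    [rho + d * T] has square [2 gamma T]. *)
Lemma calibrated_normalized v (gamma : R) T (a : R) : (1 <= T)%N -> 0 <= gamma ->
  calibrated v gamma T a ->
  exists rho d, normalized (game_of v a) T rho d (T%:R `^ (1 / 6)) (Num.sqrt (2 * gamma)).
Proof.
move=> T1 g0 cal.
have T0 : 0 < T%:R :> R by rewrite ltr0n.
have T1' : 1 <= T%:R :> R by rewrite ler1n.
have q1 : 1 <= T%:R `^ (1 / 6) :> R.
  by rewrite -[leLHS](powRr0 T%:R) ler_powR.
have qT : T%:R = (T%:R `^ (1 / 6)) ^+ 6 :> R.
  rewrite -powR_mulrn ?powR_ge0// -powRrM -[X in X = _]powRr1 ?ltW//.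
  by congr (_ `^ _); field.
have xx : Num.sqrt (2 * gamma) ^+ 2 = 2 * gamma by rewrite sqr_sqrtr// mulr_ge0.
have lossE b s : \1_[set s : R | s <= b] s = ((s <= b)%R)%:R :> R.
  by rewrite indicE; congr (_%:R); congr nat_of_bool; apply/idP/idP; rewrite inE.
have startE b : 0 <= b -> 2 * gamma * T%:R = b ^+ 2 ->
    b = Num.sqrt (2 * gamma) * Num.sqrt T%:R.
  by move=> b0 bE; rewrite -sqrtrM ?mulr_ge0// bE sqrtr_sqr ger0_norm.
case: v cal => /= -[a01 gE].
- exists 0, a; split => //.
  + rewrite add0r; apply: startE; last by rewrite gE; field.
    by case/andP: a01 => a0 _; rewrite mulr_ge0.
  + by rewrite xx gE; lra.
  + by move=> s /=; rewrite lossE oppr0.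
- exists 0, a; split => //.
  + rewrite add0r; apply: startE; last by rewrite gE; field.
    by case/andP: a01 => a0 _; rewrite mulr_ge0.
  + by rewrite xx gE; lra.
  + by move=> s /=; rewrite lossE oppr0.
- exists a, 0; split => //; first by rewrite lexx ler01.
  + by rewrite mul0r addr0; apply: startE => //; rewrite gE; field; rewrite gt_eqF.
  + by rewrite expr0n mul0r sqr_ge0.
  + by move=> s /=; rewrite lossE.
- exists a, 0; split => //; first by rewrite lexx ler01.
  + by rewrite mul0r addr0; apply: startE => //; rewrite gE; field; rewrite gt_eqF.
  + by rewrite expr0n mul0r sqr_ge0.
  + by move=> s /=; rewrite lossE.
Qed.

Lemma inv_powR_le (T : nat) n (r : R) : (1 <= T)%N -> r <= n%:R / 6 ->
  ((T%:R `^ (1 / 6)) ^+ n)^-1 <= T%:R `^ (- r) :> R.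
Proof.
move=> T1 rn; rewrite -powR_mulrn ?powR_ge0// -powRrM -powRN ler_powR ?ler1n//.
by rewrite lerN2 mulrAC mul1r.
Qed.

End calibration.

Theorem theorem1 (R : realType) (theta gamma : R)
    (htheta : 0 < theta < 2 / 3) (hgamma : 0 <= gamma) :
  (forall v : version, v = V1 \/ v = V3 ->
     potential_upper_bound v gamma
       (1 / Num.sqrt pi * gauss_tail gamma) (theta / 4) /\
     adversary_lower_bound v gamma
       (1 / Num.sqrt pi * gauss_tail gamma) (theta / 4)) /\
  (forall v : version, v = V2 \/ v = V4 ->
     potential_upper_bound v gamma
       (2 / Num.sqrt pi * gauss_tail gamma) (theta / 2) /\
     adversary_lower_bound v gamma
       (2 / Num.sqrt pi * gauss_tail gamma) (theta / 4)).
Proof.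
have -> : 2 / Num.sqrt pi * gauss_tail gamma =
    2 * (1 / Num.sqrt pi * gauss_tail gamma) by rewrite mul1r mulrA.
rewrite -Psi_sqrt//; set x0 := Num.sqrt _.
have x00 : 0 <= x0 by rewrite sqrtr_ge0.
have x02 := sqr_ge0 x0.
have C1 : 0 <= 266 + x0 ^+ 2 + x0 by lra.
have C2 : 0 <= 267 + x0 ^+ 2 + x0 by lra.
have C3 : 0 <= 540 + 2 * x0 by lra.
have C4 : 0 <= 533 + 2 * x0 ^+ 2 + 2 * x0 by lra.
(* The condition [theta < 2 / 3] gives [theta / 4 < 1 / 6] here and [theta / 2 < 1 / 3] for the next
   rate, matching [1 / q] and [1 / q ^+ 2]. *)
have rate1 T : (1 <= T)%N -> (T%:R `^ (1 / 6))^-1 <= T%:R `^ (- (theta / 4)) :> R.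
  by move=> T1; rewrite -[X in X^-1]expr1 inv_powR_le//; lra.
have rate2 T : (1 <= T)%N -> ((T%:R `^ (1 / 6)) ^+ 2)^-1 <= T%:R `^ (- (theta / 2)) :> R.
  by move=> T1; rewrite inv_powR_le//; lra.
have squares T : (T ^ 2)%N%:R <= ('X^2 : {poly R}).[T%:R] by rewrite hornerXn natrX.
split=> v hv; split.
- exists (266 + x0 ^+ 2 + x0), 1%N => T N a T1 N0 cal.
  have [rho [d nG]] := calibrated_normalized _ _ _ _ T1 hgamma cal.
  have [|f [pf sf ub]] := sign_upper_bound nG N N0.
    by case: hv => -> z /= [->|->]; rewrite ?sqrrN expr1n.
  exists f; split => // sigma psigma fsigma tau ptau.
  apply: le_trans (ub sigma psigma fsigma tau ptau) _; rewrite lerD2l.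
  exact: (ler_wpM2l C1 (rate1 T T1)).
- exists (267 + x0 ^+ 2 + x0), 1%N, (fun T => T ^ 2)%N, 'X^2; split => //.
  move=> T N a T1 N0 TN cal sigma psigma.
  have [rho [d nG]] := calibrated_normalized _ _ _ _ T1 hgamma cal.
  have [||tau ptau lb] := sign_lower_bound nG N TN N0 _ _ sigma psigma.
  + by case: hv => -> /=; right.
  + by case: hv => -> /=; left.
  exists tau => //; apply: le_trans lb; rewrite lerD2l lerN2.
  exact: (ler_wpM2l C2 (rate1 T T1)).
- exists (540 + 2 * x0), 1%N => T N a T1 N0 cal.
  have [rho [d nG]] := calibrated_normalized _ _ _ _ T1 hgamma cal.
  have [|f [pf sf ub]] := interval_upper_bound nG N N0.
    by case: hv => -> z /=; rewrite in_itv/= ler_norml.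
  exists f; split => // sigma psigma fsigma tau ptau.
  apply: le_trans (ub sigma psigma fsigma tau ptau) _; rewrite lerD2l.
  exact: (ler_wpM2l C3 (rate2 T T1)).
- exists (533 + 2 * x0 ^+ 2 + 2 * x0), 1%N, (fun T => T ^ 2)%N, 'X^2; split => //.
  move=> T N a T1 N0 TN cal sigma psigma.
  have [rho [d nG]] := calibrated_normalized _ _ _ _ T1 hgamma cal.
  have [|tau ptau lb] := interval_lower_bound nG N TN N0 _ sigma psigma.
    by case: hv => -> z /= z1; rewrite in_itv.
  exists tau => //; apply: le_trans lb; rewrite lerD2l lerN2.
  exact: (ler_wpM2l C4 (rate1 T T1)).
Qed.
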